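(* There exists a unique solution $(\boldsymbol u,\boldsymbol\omega,\phi,p)\in\mathbf H^1_0(\Omega)\times\mathbf L^2(\Omega)\times L^2(\Omega)\times H^1(\Omega)$ of the rotation-based Biot problem $$\begin{aligned}\int_\Omega\boldsymbol\omega\cdot\boldsymbol\theta+\frac1M\int_\Omega\phi\psi-\sqrt{\mu^P}\int_\Omega\boldsymbol\theta\cdot\mathbf{curl}\,\boldsymbol u+\int_\Omega\psi\,\mathrm{div}\,\boldsymbol u-\frac\alpha M\int_\Omega p\psi&=0,\\-\sqrt{\mu^P}\int_\Omega\boldsymbol\omega\cdot\mathbf{curl}\,\boldsymbol v+\int_\Omega\phi\,\mathrm{div}\,\boldsymbol v&=-\int_\Omega\boldsymbol f^P\cdot\boldsymbol v,\\\frac\alpha M\int_\Omega q\phi-\Big[c_0+\frac{\alpha^2}M\Big]\int_\Omega pq-\frac1\xi\int_\Omega\kappa\nabla p\cdot\nabla q&=-\frac\rho\xi\int_\Omega\kappa\boldsymbol g\cdot\nabla q-\int_\Omega s^Pq,\end{aligned}$$ for all $(\boldsymbol\theta,\psi)\in\mathbf L^2(\Omega)\times L^2(\Omega)$, $\boldsymbol v\in\mathbf H^1_0(\Omega)$, $q\in H^1(\Omega)$. Furthermore, there exists a constant $C>0$ such that $$|||(\boldsymbol u,\boldsymbol\omega,\phi,p)|||\le C\big\{(\mu^P)^{-1/2}\|\boldsymbol f^P\|_{0,\Omega}+\|(\kappa/\xi)^{1/2}\rho\boldsymbol g\|_{0,\Omega}+\rho_1^{1/2}\|s^P\|_{0,\Omega}\big\},$$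 where $\rho_1=\min\big((c_0+\tfrac{\alpha^2}{M})^{-1},(\kappa/\xi)^{-1}\big)$.
   Context: $\Omega\subset\mathbb R^d$, $d\in\{2,3\}$, is a bounded Lipschitz (polygonal/polyhedral) domain. Parameters: Lamé constants $\mu^P>0$, $\lambda^P\ge0$, $M:=2\mu^P+\lambda^P$; Biot–Willis parameter $\alpha>0$; storativity $c_0>0$; fluid viscosity $\xi>0$ and density $\rho>0$; scalar permeability $\kappa$ with $0<\kappa_1\le\kappa(\boldsymbol x)\le\kappa_2<\infty$; gravity $\boldsymbol g$, load $\boldsymbol f^P$ and fluid source $s^P$ are square integrable. $\|\cdot\|_{0,\Omega}$ is the $L^2(\Omega)$ norm; if $\kappa$ is not constant, the weight $\rho_1^{1/2}$ is read pointwise inside the norm. Rotations ($\boldsymbol\omega,\boldsymbol\theta$) are vector-valued for $d=3$ and scalar-valued for $d=2$, with $\mathbf{curl}\,\boldsymbol v=\partial_1v_2-\partial_2v_1$ for $d=2$. The constant $C$ does not depend on the data $\boldsymbol f^P,\boldsymbol g,s^P$ nor on the solution. With $\psi_0:=\psi-|\Omega|^{-1}\int_\Omega\psi$, the norm is $$|||(\boldsymbol v,\boldsymbol\theta,\psi,q)|||^2:=\mu^P(\|\mathbf{curl}\,\boldsymbol v\|_{0,\Omega}^2+\|\mathrm{div}\,\boldsymbol v\|_{0,\Omega}^2)+\|\boldsymbol\theta\|_{0,\Omega}^2+\frac1{\mu^P}\|\psi_0\|_{0,\Omega}^2+\frac1M\|\psi\|_{0,\Omega}^2+\Big(c_0+\frac{\alpha^2}M\Big)\|q\|_{0,\Omega}^2+\|(\kappa/\xi)^{1/2}\nabla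 q\|_{0,\Omega}^2.$$ *)

(* Defs.v *)
From HB Require Import structures.
From mathcomp Require Import all_boot all_order all_algebra.
From mathcomp Require Import all_classical all_reals all_analysis.

Set Implicit Arguments.
Unset Strict Implicit.
Unset Printing Implicit Defensive.

Import Order.TTheory GRing.Theory Num.Theory.
Import numFieldNormedType.Exports.

Local Open Scope classical_set_scope.
Local Open Scope ring_scope.

(* Product sigma-algebra on R^n, generated by the coordinates, as for tuples. *)
Section borel_rV.
Context {R : realType} (n : nat).

Let coord (i : 'I_n) (x : 'rV[R]_n) : R := x ord0 i.

Let rV_set0 : g_sigma_preimage coord set0.
Proof. exact: sigma_algebra0. Qed.

Let rV_setC A : g_sigma_preimage coord A -> g_sigma_preimage coord (~` A).
Proof. exact: sigma_algebraC. Qed.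

Let rV_bigcup (F : (set 'rV[R]_n)^nat) : (forall i, g_sigma_preimage coord (F i)) ->
  g_sigma_preimage coord (\bigcup_i (F i)).
Proof. exact: sigma_algebra_bigcup. Qed.

HB.instance Definition _ := @isMeasurable.Build default_measure_display
  'rV[R]_n (g_sigma_preimage coord) rV_set0 rV_setC rV_bigcup.

Lemma measurable_coord (i : 'I_n) :
  measurable_fun [set: 'rV[R]_n] (fun x : 'rV[R]_n => x ord0 i).
Proof.
move=> _ Y mY; rewrite setTI; apply: sub_sigma_algebra => /=.
rewrite -bigcup_seq/=; exists i => /=; first by rewrite mem_index_enum.
by exists Y => //; rewrite setTI.
Qed.

Lemma measurable_fun_rVP d (T : measurableType d) (f : T -> 'rV[R]_n) :
  (forall i, measurable_fun [set: T] (fun x => f x ord0 i)) ->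
  measurable_fun [set: T] f.
Proof.
move=> mf.
have H : g_sigma_preimage (fun i => coord i \o f) `<=` measurable.
  apply: smallest_sub; first exact: sigma_algebra_measurable.
  by rewrite -bigcup_seq; apply: bigcup_sub => i _ A [B mB <-]; exact: mf.
move=> _ A mA; apply: H; rewrite g_sigma_preimage_comp; by exists A.
Qed.

End borel_rV.

Section lebesgue_rV.
Context {R : realType}.

Definition rVcons n (p : measurableTypeR R * 'rV[R]_n) : 'rV[R]_n.+1 :=
  \row_i (if unlift ord0 i is Some j then p.2 ord0 j else p.1).

Definition rVuncons n (x : 'rV[R]_n.+1) : measurableTypeR R * 'rV[R]_n :=
  (x ord0 ord0, \row_j x ord0 (lift ord0 j)).

Lemma rVunconsK n : cancel (@rVuncons n) (@rVcons n).
Proof.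
move=> x; apply/rowP => i; rewrite mxE /=.
by case: unliftP => [j ->|->]; rewrite ?mxE.
Qed.

Lemma measurable_rVcons n : measurable_fun setT (@rVcons n).
Proof.
apply: measurable_fun_rVP => i.
under eq_fun do rewrite mxE.
case: unliftP => [j _|_]; last exact: measurable_fst.
exact: (measurableT_comp (measurable_coord j) measurable_snd).
Qed.

Lemma measurable_rVuncons n : measurable_fun setT (@rVuncons n).
Proof.
apply/measurable_fun_pair => /=; first exact: measurable_coord.
apply: measurable_fun_rVP => i; under eq_fun do rewrite mxE.
exact: measurable_coord.
Qed.

HB.instance Definition _ n :=
  isMeasurableFun.Build _ _ _ _ (@rVcons n) (@measurable_rVcons n).

Section step.
Context n (m : {sigma_finite_measure set 'rV[R]_n -> \bar R}).

Definition lebesgue_cons : set 'rV[R]_n.+1 -> \bar R :=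
  pushforward (lebesgue_measure \x m)%E (@rVcons n).

Let lebesgue_cons0 : lebesgue_cons set0 = 0%E.
Proof. by rewrite /lebesgue_cons /pushforward preimage_set0 measure0. Qed.

Let lebesgue_cons_ge0 A : (0 <= lebesgue_cons A)%E.
Proof. exact: measure_ge0. Qed.

Let lebesgue_cons_sigma_additive : semi_sigma_additive lebesgue_cons.
Proof.
exact: measure_semi_sigma_additive.
Qed.

HB.instance Definition _ := isMeasure.Build _ _ _ lebesgue_cons
  lebesgue_cons0 lebesgue_cons_ge0 lebesgue_cons_sigma_additive.

Let lebesgue_cons_sigma_finite : sigma_finite setT lebesgue_cons.
Proof.
have /sigma_finiteP[F [TF ndF Foo]] := sigma_finiteT (@lebesgue_measure R).
have /sigma_finiteP[G [TG ndG Goo]] := sigma_finiteT m.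
exists (fun k => @rVuncons n @^-1` (F k `*` G k)).
  rewrite -preimage_bigcup -[LHS](preimage_setT (@rVuncons n)).
  congr (_ @^-1` _); rewrite -setXTT TF TG predeqE => -[x y]; split.
    move=> [/= [i _ Fix] [k _ Gky]]; exists (maxn i k) => //; split.
    - by move: x Fix; exact/subsetPset/ndF/leq_maxl.
    - by move: y Gky; exact/subsetPset/ndG/leq_maxr.
  by move=> [i _ []/= ? ?]; split; exists i.
move=> k; have [mFk Fk] := Foo k; have [mGk Gk] := Goo k; split.
  rewrite -[X in measurable X]setTI.
  by apply: measurable_rVuncons => //; exact: measurableX.
rewrite /lebesgue_cons /pushforward -comp_preimage.
have -> : (@rVuncons n \o @rVcons n) = id.
  apply/funext => -[a b]; rewrite /rVuncons /=; congr (_, _).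
    by rewrite mxE unlift_none.
  by apply/rowP => j; rewrite !mxE liftK.
by rewrite preimage_id product_measure1E// lte_mul_pinfty// ge0_fin_numE.
Qed.

HB.instance Definition _ := @Measure_isSigmaFinite.Build _ _ _
  lebesgue_cons lebesgue_cons_sigma_finite.

End step.

Fixpoint lebesgue_rV n : {sigma_finite_measure set 'rV[R]_n -> \bar R} :=
  match n with
  | 0 => @dirac _ 'rV[R]_0 0 R
  | n'.+1 => lebesgue_cons (lebesgue_rV n')
  end.

Lemma measurable_box n (A : 'I_n -> set R) : (forall i, measurable (A i)) ->
  measurable [set x : 'rV[R]_n | forall i, A i (x ord0 i)].
Proof.
move=> mA; rewrite (_ : mkset _ =
    \bigcap_(i in [set: 'I_n]) ((fun x : 'rV[R]_n => x ord0 i) @^-1` A i)).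
  apply: fin_bigcap_measurable => // i _.
  rewrite -[X in measurable X]setTI; exact: measurable_coord.
by apply/seteqP; split => [x /= xA i _|x /= xA i]; exact: xA.
Qed.

Lemma lebesgue_rV_box n (A : 'I_n -> set (measurableTypeR R)) :
  (forall i, measurable (A i)) ->
  lebesgue_rV n [set x | forall i, A i (x ord0 i)] =
  (\prod_(i < n) lebesgue_measure (A i))%E.
Proof.
elim: n A => [|n IH] A mA.
  by rewrite big_ord0 /= diracE mem_set// => -[].
rewrite big_ord_recl -IH; last by move=> i; exact: mA.
have mB := measurable_box (fun i => mA (lift ord0 i)).
rewrite /= -product_measure1E//.
rewrite /lebesgue_cons /pushforward; congr (_ _).
apply/seteqP; split => [[a b] /= H|[a b] /= [H0 H] i].
  split; first by have := H ord0; rewrite mxE unlift_none.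
  by move=> i; have := H (lift ord0 i); rewrite mxE liftK.
by rewrite mxE; case: unliftP => [j ->|->].
Qed.

End lebesgue_rV.

Section sobolev.
Context {R : realType} {d : nat}.
Local Notation E := 'rV[R]_d.
Local Notation mu := (@lebesgue_rV R d).
Implicit Type Omega : set E.

Definition L2 Omega (f : E -> R) : Prop :=
  measurable_fun Omega f /\ mu.-integrable Omega (fun x => (f x ^+ 2)%:E).

Definition L2v m Omega (v : 'I_m -> E -> R) : Prop := forall k, L2 Omega (v k).

Definition dot m (v w : 'I_m -> E -> R) : E -> R :=
  fun x => \sum_(k < m) v k x * w k x.

Definition norm0 Omega (f : E -> R) : R :=
  Num.sqrt (\int[mu]_(x in Omega) (f x ^+ 2)).

Definition norm0v m Omega (v : 'I_m -> E -> R) : R :=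
  Num.sqrt (\int[mu]_(x in Omega) dot v v x).

Definition mean_free Omega (f : E -> R) : E -> R :=
  fun x => f x - (fine (mu Omega))^-1 * \int[mu]_(y in Omega) f y.

Definition partial (i : 'I_d) (f : E -> R) : E -> R :=
  fun x => 'D_(delta_mx ord0 i) f x.

(* Every iterated partial derivative exists everywhere and is continuous. *)
Definition smooth (f : E -> R) : Prop :=
  forall s : seq 'I_d, let g := foldr partial f s in
    continuous g /\ forall i x, derivable g x (delta_mx ord0 i).

Definition test_function Omega (f : E -> R) : Prop :=
  let supp := closure [set x | f x != 0] in
  [/\ smooth f, compact supp & supp `<=` Omega].

Definition weak_partial Omega (i : 'I_d) (f g : E -> R) : Prop :=
  forall phi, test_function Omega phi ->
    \int[mu]_(x in Omega) (f x * partial i phi x) =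
    - \int[mu]_(x in Omega) (g x * phi x).

(* An element of H^1(Omega) is a representative [H1fun] together with
   a representative [grad] of its weak gradient; the latter is determined by the
   former up to a null set.  Elements are identified by [eqH1]. *)
Record H1 Omega := {
  H1fun :> E -> R;
  grad : 'I_d -> E -> R;
  H1fun_L2 : L2 Omega H1fun;
  grad_L2 : L2v Omega grad;
  gradP : forall i, weak_partial Omega i H1fun (grad i) }.

Definition eqH1 Omega (p q : H1 Omega) : Prop :=
  ae_eq mu Omega p q /\ forall i, ae_eq mu Omega (grad p i) (grad q i).

(* Closure of the test functions in the norm of H^1(Omega). *)
Definition in_H10 Omega (v : H1 Omega) : Prop :=
  forall e : R, 0 < e -> exists phi, [/\ test_function Omega phi,
    norm0 Omega (v \- phi) < e &
    forall i, norm0 Omega (grad v i \- partial i phi) < e].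

Definition H10v Omega (v : 'I_d -> H1 Omega) : Prop := forall i, in_H10 (v i).

Definition divergence Omega (v : 'I_d -> H1 Omega) : E -> R :=
  fun x => \sum_(i < d) grad (v i) i x.

(* Near each boundary point, in suitable orthonormal coordinates [x *m Q],
   [Omega] is the set of points lying above the graph, over the coordinates
   other than the [i]-th, of a Lipschitz function. *)
Definition lipschitz_boundary Omega : Prop :=
  forall x0, closure Omega x0 -> ~ interior Omega x0 ->
  exists (Q : 'M[R]_d) (i : 'I_d) (gamma : 'rV[R]_d.-1 -> R) (r : R),
    [/\ Q *m Q^T = 1%:M, lipschitz gamma, 0 < r &
      forall x, ball x0 r x ->
        (Omega x <-> gamma (col' i (x *m Q)) < (x *m Q) ord0 i)].

Definition bounded_lipschitz_domain Omega : Prop :=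
  [/\ Omega !=set0, open Omega, connected Omega, bounded_set Omega &
      lipschitz_boundary Omega].

End sobolev.

Definition rot_dim (d : nat) : nat := match d with 2 => 1%N | _ => 3%N end.

(* [G i j] stands for the j-th partial derivative of the i-th component.  For
   [d = 3] the indices are taken in the ring ['I_3] of integers modulo 3; the
   dimensions other than 2 and 3 get a dummy value. *)
Definition curl_mx (R : realType) (d : nat) :
    ('I_d -> 'I_d -> R) -> 'I_(rot_dim d) -> R :=
  match d return ('I_d -> 'I_d -> R) -> 'I_(rot_dim d) -> R with
  | 2 => fun G _ => G 1 0 - G 0 1
  | 3 => fun G k => G (k + 2) (k + 1) - G (k + 1) (k + 2)
  | _ => fun _ _ => 0
  end.

Section biot.
Context {R : realType} {d : nat}.
Local Notation E := 'rV[R]_d.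
Local Notation mu := (@lebesgue_rV R d).
Variables (Omega : set E) (muP lambdaP alpha c0 xi rho : R) (kappa : E -> R).

Definition curl (v : 'I_d -> H1 Omega) : 'I_(rot_dim d) -> E -> R :=
  fun k x => curl_mx (fun i j => grad (v i) j x) k.

Definition lameM : R := 2 * muP + lambdaP.

Local Notation M := lameM.

Definition biot_solution (f g : 'I_d -> E -> R) (s : E -> R)
    (u : 'I_d -> H1 Omega) (omega : 'I_(rot_dim d) -> E -> R)
    (phi : E -> R) (p : H1 Omega) : Prop :=
  [/\ [/\ H10v u, L2v Omega omega & L2 Omega phi],
   forall theta psi, L2v Omega theta -> L2 Omega psi ->
     \int[mu]_(x in Omega) dot omega theta x
     + M^-1 * \int[mu]_(x in Omega) (phi x * psi x)
     - Num.sqrt muP * \int[mu]_(x in Omega) dot theta (curl u) x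
     + \int[mu]_(x in Omega) (psi x * divergence u x)
     - alpha / M * \int[mu]_(x in Omega) (p x * psi x) = 0,
   forall v, H10v v ->
     - Num.sqrt muP * \int[mu]_(x in Omega) dot omega (curl v) x
     + \int[mu]_(x in Omega) (phi x * divergence v x)
     = - \int[mu]_(x in Omega) dot f (fun i => v i) x &
   forall q : H1 Omega,
     alpha / M * \int[mu]_(x in Omega) (q x * phi x)
     - (c0 + alpha ^+ 2 / M) * \int[mu]_(x in Omega) (p x * q x)
     - xi^-1 * \int[mu]_(x in Omega) (kappa x * dot (grad p) (grad q) x)
     = - (rho / xi) * \int[mu]_(x in Omega) (kappa x * dot g (grad q) x)
       - \int[mu]_(x in Omega) (s x * q x)].

Definition weighted m (w : E -> R) (v : 'I_m -> E -> R) : 'I_m -> E -> R :=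
  fun k x => w x * v k x.

Definition sqrt_kappa_xi : E -> R := fun x => Num.sqrt (kappa x / xi).

Definition energy_norm (v : 'I_d -> H1 Omega)
    (theta : 'I_(rot_dim d) -> E -> R) (psi : E -> R) (q : H1 Omega) : R :=
  Num.sqrt (muP * (norm0v Omega (curl v) ^+ 2 + norm0 Omega (divergence v) ^+ 2)
    + norm0v Omega theta ^+ 2
    + muP^-1 * norm0 Omega (mean_free Omega psi) ^+ 2
    + M^-1 * norm0 Omega psi ^+ 2
    + (c0 + alpha ^+ 2 / M) * norm0 Omega q ^+ 2
    + norm0v Omega (weighted sqrt_kappa_xi (grad q)) ^+ 2).

Definition rho1 : E -> R :=
  fun x => Num.min (c0 + alpha ^+ 2 / M)^-1 (kappa x / xi)^-1.

Definition data_norm (f g : 'I_d -> E -> R) (s : E -> R) : R :=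
  (Num.sqrt muP)^-1 * norm0v Omega f
  + norm0v Omega (weighted sqrt_kappa_xi (fun i x => rho * g i x))
  + norm0 Omega (fun x => Num.sqrt (rho1 x) * s x).

End biot.

(* Main.v *)
(** The first equation says that omega = sqrt(mu) curl u and phi = alpha p - M div u.
    Substituting, (u, p) solves a(w, z) = l(z) with
      a(w, z) = mu (curl u, curl v) + M (div u, div v) + c0 (p, q)
                + xi^-1 (kappa grad p, grad q) + alpha (div u, q) - alpha (p, div v).
    The two coupling terms cancel for z = w.  Mixed derivatives of test functions commute,
    so |curl u|^2 + |div u|^2 = |grad u|^2 on H^1_0, and with Friedrichs' inequality a is
    coercive; Lax-Milgram gives existence and uniqueness, and coercivity the estimate.
    As C may depend on the parameters, the crude bound |phi_0| <= C |phi| suffices. *)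
Require Import Defs.
From mathcomp Require Import all_boot all_order all_algebra.
From mathcomp Require Import all_classical all_reals all_analysis.
From mathcomp Require Import measurable_realfun.
From mathcomp Require Import ring lra.

Set Implicit Arguments.
Unset Strict Implicit.
Unset Printing Implicit Defensive.

Import Order.TTheory GRing.Theory Num.Theory.
Import numFieldNormedType.Exports.

Local Open Scope classical_set_scope.
Local Open Scope ring_scope.

(** * Semi-inner products *)

(** Functions that agree almost everywhere are not identified, so no Hilbert space is at hand: the
    functional analysis is done for a semi-inner product [b] restricted to a subset [S] of a module
    of arbitrary functions. Equality becomes vanishing of the seminorm of a difference, and is
    turned into almost everywhere equality only for the uniqueness claim. The records [H1] carry
    proofs and have no module structure. They are traded for jets, families of functions that hold
    the weak derivatives as separate components. The H^1 norm is then the L2 norm of the family, and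
    completeness reduces to that of L2, because weak derivatives and approximability by test
    functions survive L2 limits. The form a is not symmetric, so Riesz' theorem alone does not solve
    the problem. Since M >= mu, the terms mu |curl u|^2 + M |div u|^2 dominate mu |grad u|^2; for
    the pressure, [c0] weights |p|^2 and [kappa1 / xi] weights |grad p|^2 directly. *)

Lemma discriminant_le0 (R : realFieldType) (A B c : R) : 0 <= A ->
  (forall t, 0 <= t ^+ 2 * A + 2 * t * B + c) -> B ^+ 2 <= A * c.
Proof.
move=> A0 H; have [A_eq0|A_neq0] := eqVneq A 0.
  have [->|B0] := eqVneq B 0; first by rewrite A_eq0 mul0r expr0n.
  (* With [A = 0] the polynomial is affine, and at this [t] it takes the value -1. *)
  have := H (- (c + 1) / (2 * B)).
  rewrite A_eq0 mulr0 add0r.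
  rewrite (_ : 2 * _ * B = - (c + 1)); last by field.
  by lra.
have A_gt0 : 0 < A by rewrite lt_neqAle eq_sym A_neq0.
have := H (- B / A).
rewrite (_ : _ + c = (A * c - B ^+ 2) / A); last by field.
by rewrite pmulr_lge0 ?invr_gt0// subr_ge0.
Qed.

Lemma eq0_small (R : realFieldType) (x : R) :
  (forall e : R, 0 < e -> `|x| <= e) -> x = 0.
Proof.
move=> H; apply/eqP; rewrite -normr_eq0 eq_le normr_ge0 andbT.
by apply/ler_addgt0Pl => e e0; rewrite addr0; exact: H.
Qed.

Record subspace (R : realType) (W : lmodType R) (S : set W) : Prop := {
  subspace0 : S 0;
  subspaceL : forall a x y, S x -> S y -> S (a *: x + y) }.

Record bilinear_on (R : realType) (W : lmodType R) (S : set W)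
    (b : W -> W -> R) : Prop := {
  bilinearl : forall a x y z, S x -> S y -> S z ->
    b (a *: x + y) z = a * b x z + b y z;
  bilinearr : forall a x y z, S x -> S y -> S z ->
    b z (a *: x + y) = a * b z x + b z y }.

Record semi_inner (R : realType) (W : lmodType R) (S : set W)
    (b : W -> W -> R) : Prop := {
  semi_inner_subspace : subspace S;
  semi_inner_bilinear : bilinear_on S b;
  semi_inner_sym : forall x y, S x -> S y -> b x y = b y x;
  semi_inner_ge0 : forall x, S x -> 0 <= b x x }.

Definition snorm (R : realType) (W : Type) (b : W -> W -> R) (x : W) : R :=
  Num.sqrt (b x x).

(** The limit [y] need not be unique: for a semi-inner product it may be changed by any element of
    [S] of seminorm zero. *)
Definition complete_for (R : realType) (W : lmodType R) (S : set W)
    (b : W -> W -> R) : Prop :=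
  forall x : nat -> W, (forall n, S (x n)) ->
  (forall e : R, 0 < e -> exists N, forall m n, (N <= m)%N -> (N <= n)%N ->
     snorm b (x m - x n) <= e) ->
  exists2 y, S y & forall e : R, 0 < e -> exists N, forall n, (N <= n)%N ->
     snorm b (x n - y) <= e.

Section subspace_theory.
Context (R : realType) (W : lmodType R) (S : set W) (hS : subspace S).

Lemma subspaceD x y : S x -> S y -> S (x + y).
Proof. by move=> Sx Sy; rewrite -[x]scale1r; exact: subspaceL. Qed.

Lemma subspaceZ a x : S x -> S (a *: x).
Proof. by move=> Sx; rewrite -[_ *: _]addr0; apply: subspaceL => //; case: hS. Qed.

Lemma subspaceB x y : S x -> S y -> S (x - y).
Proof. by move=> Sx Sy; rewrite addrC -scaleN1r; exact: subspaceL. Qed.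

Context (b : W -> W -> R) (hb : bilinear_on S b).

Lemma bilinear_onBl x y z : S x -> S y -> S z -> b (x - y) z = b x z - b y z.
Proof. by move=> *; rewrite addrC -scaleN1r (bilinearl hb)// mulN1r addrC. Qed.

Lemma bilinear_onBr x y z : S x -> S y -> S z -> b z (x - y) = b z x - b z y.
Proof. by move=> *; rewrite addrC -scaleN1r (bilinearr hb)// mulN1r addrC. Qed.

Lemma bilinear_on0l z : S z -> b 0 z = 0.
Proof.
move=> Sz; have S0 := subspace0 hS.
by rewrite -[0 in LHS](subrr 0) bilinear_onBl// subrr.
Qed.

Lemma bilinear_on0r z : S z -> b z 0 = 0.
Proof.
move=> Sz; have S0 := subspace0 hS.
by rewrite -[0 in LHS](subrr 0) bilinear_onBr// subrr.
Qed.

Lemma bilinear_onZl a x z : S x -> S z -> b (a *: x) z = a * b x z.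
Proof.
move=> Sx Sz; have S0 := subspace0 hS.
by rewrite -[_ *: _]addr0 (bilinearl hb)// bilinear_on0l// addr0.
Qed.

Lemma bilinear_onZr a x z : S x -> S z -> b z (a *: x) = a * b z x.
Proof.
move=> Sx Sz; have S0 := subspace0 hS.
by rewrite -[_ *: _]addr0 (bilinearr hb)// bilinear_on0r// addr0.
Qed.

End subspace_theory.

Section semi_inner_theory.
Context (R : realType) (W : lmodType R) (S : set W) (b : W -> W -> R).
Hypothesis (hb : semi_inner S b).

Let hS := semi_inner_subspace hb.
Let bl := semi_inner_bilinear hb.
Let bC := semi_inner_sym hb.
Let b0 := semi_inner_ge0 hb.

Lemma snorm_ge0 x : 0 <= snorm b x.
Proof. exact: sqrtr_ge0. Qed.

Lemma sqr_snorm x : S x -> snorm b x ^+ 2 = b x x.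
Proof. by move=> Sx; rewrite sqr_sqrtr// b0. Qed.

Lemma semi_inner_expand a x y : S x -> S y ->
  b (a *: x + y) (a *: x + y) = a ^+ 2 * b x x + 2 * a * b x y + b y y.
Proof.
move=> Sx Sy; have Sa : S (a *: x + y) by exact: (subspaceL hS).
by rewrite (bilinearl bl)// !(bilinearr bl)// (bC Sy Sx); ring.
Qed.

Lemma cauchy_schwarz x y : S x -> S y -> `|b x y| <= snorm b x * snorm b y.
Proof.
move=> Sx Sy; rewrite -sqrtrM ?b0// -sqrtr_sqr ler_wsqrtr//.
apply: discriminant_le0 => [|t]; first exact: b0.
by rewrite -semi_inner_expand// b0//; exact: (subspaceL hS).
Qed.

Lemma snormD x y : S x -> S y -> snorm b (x + y) <= snorm b x + snorm b y.
Proof.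
move=> Sx Sy; rewrite -(@ler_pXn2r _ 2)// ?nnegrE ?addr_ge0 ?snorm_ge0//.
rewrite sqr_snorm; last exact: subspaceD.
rewrite -[x in b (x + _)]scale1r -[x in b _ (x + _)]scale1r semi_inner_expand//.
rewrite sqrrD !sqr_snorm// expr1n.
have := cauchy_schwarz Sx Sy; have := ler_norm (b x y); lra.
Qed.

Lemma snormZ a x : S x -> snorm b (a *: x) = `|a| * snorm b x.
Proof.
move=> Sx; have Sa : S (a *: x) by exact: subspaceZ.
rewrite /snorm (bilinear_onZl hS bl)// (bilinear_onZr hS bl)// mulrA -expr2.
by rewrite sqrtrM ?sqr_ge0// sqrtr_sqr.
Qed.

Lemma snormB x y : S x -> S y -> snorm b (x - y) <= snorm b x + snorm b y.
Proof.
move=> Sx Sy; rewrite -scaleN1r.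
rewrite (le_trans (snormD _ _))//; first exact: subspaceZ.
by rewrite snormZ// normrN1 mul1r.
Qed.

Lemma snormBC x y : S x -> S y -> snorm b (x - y) = snorm b (y - x).
Proof.
move=> Sx Sy; rewrite (_ : x - y = -1 *: (y - x)); last first.
  by rewrite scaleN1r opprB.
by rewrite snormZ ?normrN1 ?mul1r//; exact: subspaceB.
Qed.

Hypothesis cb : complete_for S b.

Section riesz.
Variables (l : W -> R) (C : R).
Hypothesis ll : forall a x y, S x -> S y -> l (a *: x + y) = a * l x + l y.
Hypothesis lC : forall x, S x -> `|l x| <= C * snorm b x.

(** The quadratic energy whose minimizer represents [l]. *)
Let J x := b x x - 2 * l x.

Let J_ge x : S x -> - C ^+ 2 <= J x.
Proof.
move=> Sx; have := lC Sx; have := ler_norm (l x).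
rewrite /J -sqr_snorm//; set n := snorm _ _ => h1 h2.
have := sqr_ge0 (n - C); rewrite sqrrB -mulr_natl; lra.
Qed.

Let JD t x y : S x -> S y ->
  J (t *: y + x) = J x + t ^+ 2 * b y y + 2 * t * (b x y - l y).
Proof.
move=> Sx Sy; rewrite /J semi_inner_expand// ll// (bC Sy Sx); ring.
Qed.

(** The midpoint cannot fall below the infimum of [J], so two near-minimizers are close to each
    other: minimizing sequences are Cauchy. *)
Let J_parallelogram x y : S x -> S y ->
  snorm b (x - y) ^+ 2 = 2 * J x + 2 * J y - 4 * J (2^-1 *: x + 2^-1 *: y).
Proof.
move=> Sx Sy; have Sh : S (2^-1 *: y) by exact: subspaceZ.
rewrite JD// sqr_snorm; last exact: subspaceB.
rewrite -[2^-1 *: y]addr0 JD//; last exact: (subspace0 hS).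
rewrite addr0 (bilinear_onZl hS bl)// -scaleN1r addrC semi_inner_expand//.
have -> : J 0 = 0.
  rewrite /J (bilinear_on0l hS bl)//; last exact: (subspace0 hS).
  have := ll 1 (subspace0 hS) (subspace0 hS).
  by rewrite scaler0 addr0 mul1r; lra.
rewrite (bilinear_on0l hS bl)//.
by rewrite /J (bC Sy Sx); field.
Qed.

Theorem riesz_representation : exists2 x, S x & forall y, S y -> b x y = l y.
Proof.
pose A := [set J x | x in S].
have hA : has_inf A.
  split; first by exists (J 0), 0 => //; exact: (subspace0 hS).
  by exists (- C ^+ 2) => _ [x Sx <-]; exact: J_ge.
have eps_gt0 k : 0 < k.+1%:R^-1 :> R by rewrite invr_gt0.
have /choice[x hx] k : exists x, S x /\ J x < inf A + k.+1%:R^-1.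
  by have [_ [x Sx <-] ?] := inf_adherent (eps_gt0 k) hA; exists x.
have Jinf y : S y -> inf A <= J y.
  by move=> Sy; apply: ge_inf; [exact: (proj2 hA)|exists y].
have small (e : R) : 0 < e -> exists N, forall n, (N <= n)%N -> n.+1%:R^-1 <= e.
  move=> e0; exists (Num.truncn e^-1) => n Nn.
  rewrite -[e]invrK lef_pV2 ?posrE ?invr_gt0//.
  rewrite (le_trans (ltW (truncnS_gt _)))//.
  by rewrite ler_nat ltnS.
have Sxn n : S (x n) by case: (hx n).
have [] := cb Sxn.
  (* Two values within [e ^+ 2 / 4] of the infimum contribute twice each to the parallelogram
     identity, [e ^+ 2] in all. *)
  move=> e e0; have [|N hN] := small (e ^+ 2 / 4).
    by rewrite divr_gt0// exprn_gt0.
  exists N => m n Nm Nn.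
  rewrite -(@ler_pXn2r _ 2)// ?nnegrE ?snorm_ge0 ?(ltW e0)//.
  rewrite J_parallelogram//.
  have [_ h1] := hx m; have [_ h2] := hx n.
  have := hN _ Nm; have := hN _ Nn.
  move: (m.+1%:R^-1) (n.+1%:R^-1) h1 h2 => im iN h1 h2.
  have : inf A <= J (2^-1 *: x m + 2^-1 *: x n).
    by apply: Jinf; apply: (subspaceL hS) => //; exact: subspaceZ.
  lra.
move=> z Sz hz; exists z => // y Sy.
(* [x k] minimizes up to 1/(k+1), so a quadratic in [t] is nonnegative and its discriminant bounds
   the defect in the Euler equation. That equation then passes to the limit [z] by continuity of [b]
   alone. *)
have bnd k : `|b (x k) y - l y| ^+ 2 <= b y y * k.+1%:R^-1.
  rewrite real_normK ?num_real//; apply: discriminant_le0 => [|t]; first exact: b0.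
  have [_ h1] := hx k.
  have := Jinf (t *: y + x k); rewrite JD// => h2.
  have /h2 : S (t *: y + x k) by exact: (subspaceL hS).
  move: (k.+1%:R^-1) h1 => ik h1 {}h2.
  lra.
apply/eqP; rewrite -subr_eq0; apply/eqP/eq0_small => e e0.
have e20 : 0 < e / 2 by lra.
have ny1 : 0 < snorm b y + 1 by have := snorm_ge0 y; lra.
have [|N1 hN1] := hz (e / 2 / (snorm b y + 1)); first exact: divr_gt0.
have [|N2 hN2] := small ((e / 2) ^+ 2 / (b y y + 1)).
  by rewrite divr_gt0 ?exprn_gt0//; have := b0 Sy; lra.
pose N := maxn N1 N2.
have h1 : `|b (x N) y - l y| <= e / 2.
  rewrite -(@ler_pXn2r _ 2)// ?nnegrE// ?(ltW e20)//.
  apply: (le_trans (bnd N)).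
  have := hN2 N (leq_maxr _ _); rewrite ler_pdivlMr; last by have := b0 Sy; lra.
  apply: le_trans; rewrite mulrC ler_wpM2l ?lerDl//.
have h2 : `|b (x N - z) y| <= e / 2.
  apply: (le_trans (cauchy_schwarz _ Sy)); first exact: subspaceB.
  have := hN1 N (leq_maxl _ _); rewrite ler_pdivlMr// => h; apply: le_trans h.
  by rewrite ler_wpM2l ?snorm_ge0 ?lerDl.
rewrite (bilinear_onBl bl)// in h2.
rewrite (_ : b z y - l y = (b (x N) y - l y) - (b (x N) y - b z y)); last by ring.
by rewrite (le_trans (ler_normB _ _))//; lra.
Qed.

End riesz.

(** Riesz represents the residual [a x - l] by [A x], a damped iteration drives it to zero, and
    coercivity turns small residuals into a Cauchy sequence. Only the seminorm of [A x] is
    estimated, since [A x] is determined only up to seminorm zero. *)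
Theorem lax_milgram (a : W -> W -> R) (l : W -> R) (C c C' : R) :
  bilinear_on S a -> 0 < c ->
  (forall x y, S x -> S y -> `|a x y| <= C * snorm b x * snorm b y) ->
  (forall x, S x -> c * b x x <= a x x) ->
  (forall t x y, S x -> S y -> l (t *: x + y) = t * l x + l y) ->
  (forall x, S x -> `|l x| <= C' * snorm b x) ->
  exists2 x, S x & forall y, S y -> a x y = l y.
Proof.
move=> al c0 aC ac ll lC.
have rep x : exists z, S x -> S z /\ forall y, S y -> b z y = a x y - l y.
  have [Sx|nSx] := pselect (S x); last by exists 0.
  have [|y Sy|z Sz hz] :=
    @riesz_representation (fun y => a x y - l y) (C * snorm b x + C').
  - by move=> t y z Sy Sz; rewrite (bilinearr al)// ll//; ring.
  - rewrite mulrDl (le_trans (ler_normB _ _))// lerD ?aC ?lC//.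
  by exists z.
have {rep}[A hA] := choice rep.
have SA x : S x -> S (A x) by move=> /hA[].
have bA x y : S x -> S y -> b (A x) y = a x y - l y.
  by move=> /hA[_]; exact.
(* Adding [c] makes [K] positive and at least [c], so that [0 <= q < 1]. The step [t] minimizes
   [1 - 2 * c * t + K ^+ 2 * t ^+ 2], and [q] is the minimum. *)
pose K : R := `|C| + c; pose q : R := 1 - c ^+ 2 / K ^+ 2;
have [t tE] : {t : R | t = c / K ^+ 2} by exists (c / K ^+ 2).
have K0 : 0 < K by rewrite ltr_wpDl.
have aK x y : S x -> S y -> `|a x y| <= K * snorm b x * snorm b y.
  move=> Sx Sy; apply: (le_trans (aC _ _ Sx Sy)).
  rewrite ler_wpM2r ?snorm_ge0// ler_wpM2r ?snorm_ge0//.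
  by rewrite (le_trans (ler_norm _))// lerDl ltW.
have q0 : 0 <= q.
  rewrite subr_ge0 ler_pdivrMr ?exprn_gt0// mul1r lerXn2r ?nnegrE ?(ltW c0) ?(ltW K0)//.
  rewrite /K; have := normr_ge0 C; lra.
have q1 : q < 1 by rewrite ltrBlDr ltrDl divr_gt0 ?exprn_gt0.
(* One step of the iteration [x - t * A x] contracts the residual [A x]. *)
have step x : S x ->
    b (A (x - t *: A x)) (A (x - t *: A x)) <= q * b (A x) (A x).
  move=> Sx; have SAx := SA _ Sx.
  have Stx : S (t *: A x) by exact: subspaceZ.
  have Sx' : S (x - t *: A x) by exact: subspaceB.
  have SAx' := SA _ Sx'; set r := A x; set r' := A _.
  (* As [b e y = t * a r y], expanding the square of [r - e] gives the square of [r], minus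
     [2 * t * a r r], plus [b e e]. Coercivity bounds the middle term and [aK] the last, with total
     factor [q]. *)
  pose e := r - r'.
  have Se : S e by exact: subspaceB.
  have be y : S y -> b e y = t * a r y.
    move=> Sy; rewrite /e (bilinear_onBl bl)// !bA// (bilinear_onBl al)//.
    rewrite (bilinear_onZl hS al)//; ring.
  have -> : r' = (-1) *: e + r by rewrite scaleN1r /e opprB subrK.
  rewrite semi_inner_expand// (be r)//.
  have he : b e e <= (t * K) ^+ 2 * b r r.
    have t0 : 0 < t by rewrite tE divr_gt0 ?exprn_gt0.
    have : snorm b e * snorm b e <= t * K * snorm b r * snorm b e.
      rewrite -[X in X <= _]expr2 sqr_snorm// be// -!mulrA ler_pM2l// mulrA.
      apply: (le_trans (ler_norm _)). exact: aK.
    rewrite -!sqr_snorm// -exprMn => h.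
    rewrite lerXn2r ?nnegrE ?snorm_ge0 ?mulr_ge0 ?snorm_ge0 ?(ltW t0) ?(ltW K0)//.
    have [n0|n0] := eqVneq (snorm b e) 0.
      by rewrite n0 !mulr_ge0 ?snorm_ge0// ltW.
    by rewrite -(@ler_pM2r _ (snorm b e))// lt_neqAle eq_sym n0 snorm_ge0.
  have hr : t * (c * b r r) <= t * a r r.
    by rewrite ler_wpM2l ?ac// tE divr_ge0 ?exprn_ge0 ?(ltW c0) ?(ltW K0).
  have -> : q * b r r = (t * K) ^+ 2 * b r r - 2 * (t * (c * b r r)) + b r r.
    by rewrite /q tE; field; rewrite gt_eqF.
  lra.
have /choice[x hx] k : exists x,
    S x /\ b (A x) (A x) <= q ^+ k * b (A 0) (A 0).
  elim: k => [|k [x [Sx hx]]].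
    by exists 0; rewrite mul1r; split => //; exact: (subspace0 hS).
  exists (x - t *: A x); split.
    by apply: subspaceB => //; apply: subspaceZ => //; exact: SA.
  by rewrite (le_trans (step _ Sx))// exprS -mulrA ler_wpM2l.
have Sxk k : S (x k) by case: (hx k).
have small e : 0 < e -> exists N, forall n, (N <= n)%N -> snorm b (A (x n)) <= e.
  move=> e0; have S0 := subspace0 hS.
  have : (fun n => q ^+ n * b (A 0) (A 0)) @ \oo --> 0 * b (A 0) (A 0).
    by apply: cvgMl; apply: cvg_expr; rewrite ger0_norm.
  rewrite mul0r => /cvgrPdist_lt/(_ (e ^+ 2) (exprn_gt0 2 e0))[N _ hN].
  exists N => n Nn; have SAn := SA _ (Sxk n).
  rewrite -(@ler_pXn2r _ 2)// ?nnegrE ?snorm_ge0 ?(ltW e0)// sqr_snorm//.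
  have [_ h] := hx n; apply: (le_trans h).
  have := hN n Nn; rewrite /= sub0r normrN => h'.
  by rewrite (le_trans (ler_norm _))// ltW.
(* The load [l] cancels in [A y - A z], so coercivity makes [A] expanding. *)
have inj y z : S y -> S z -> c * snorm b (y - z) <= snorm b (A y) + snorm b (A z).
  move=> Sy Sz; have Syz : S (y - z) by exact: subspaceB.
  have SAyz : S (A y - A z) by apply: subspaceB => //; exact: SA.
  have [n0|n0] := eqVneq (snorm b (y - z)) 0.
    by rewrite n0 mulr0 addr_ge0 ?snorm_ge0.
  rewrite (le_trans _ (snormB (SA _ Sy) (SA _ Sz)))//.
  rewrite -(@ler_pM2r _ (snorm b (y - z))) ?lt_neqAle ?(eq_sym 0) ?n0 ?snorm_ge0//.
  rewrite -mulrA -expr2 sqr_snorm// (le_trans (ac _ Syz))//.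
  apply: le_trans (cauchy_schwarz SAyz Syz); apply: le_trans (ler_norm _).
  rewrite (bilinear_onBl bl)//; [|exact: SA|exact: SA].
  by rewrite !bA// (bilinear_onBl al)//; lra.
have [] := cb Sxk.
  move=> e e0; have [|N hN] := small (c * e / 2).
    by rewrite divr_gt0// mulr_gt0.
  exists N => m n Nm Nn; rewrite -(ler_pM2l c0) (le_trans (inj _ _ _ _))//.
  have := hN _ Nm; have := hN _ Nn; lra.
move=> z Sz hz; exists z => // y Sy.
apply/eqP; rewrite -subr_eq0; apply/eqP/eq0_small => e e0.
have ny1 : 0 < snorm b y + 1 by have := snorm_ge0 y; lra.
have [|N1 hN1] := hz (e / 2 / (K * (snorm b y + 1))).
  by rewrite !divr_gt0// mulr_gt0.
have [|N2 hN2] := small (e / 2 / (snorm b y + 1)).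
  by rewrite !divr_gt0.
have {hN1} := hN1 _ (leq_maxl N1 N2); have {hN2} := hN2 _ (leq_maxr N1 N2).
set N := maxn _ _; have SAN := SA _ (Sxk N).
have Sd : S (x N - z) by exact: subspaceB.
rewrite ler_pdivlMr// => h1; rewrite ler_pdivlMr ?mulr_gt0// => h2.
have := aK _ _ Sd Sy; have := cauchy_schwarz SAN Sy.
rewrite bA// (bilinear_onBl al)// => h3 h4.
rewrite (_ : a z y - l y = (a (x N) y - l y) - (a (x N) y - a z y)); last by ring.
rewrite (le_trans (ler_normB _ _))//.
have := snorm_ge0 (A (x N)); have := snorm_ge0 (x N - z).
set n1 := snorm b (x N - z) in h2 h4 *; set n2 := snorm b (A _) in h1 h3 *.
move=> p1 p2; have := mulr_ge0 (ltW K0) p1; lra.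
Qed.


End semi_inner_theory.

(** * The space L2 *)

Section L2_theory.
Context (R : realType) (d : nat) (Omega : set 'rV[R]_d).
Hypothesis mO : measurable Omega.
Local Notation E := 'rV[R]_d.
Local Notation mu := (@lebesgue_rV R d).

Definition ip (f g : E -> R) : R := \int[mu]_(x in Omega) (f x * g x).

Lemma integrable_le (f g : E -> R) : measurable_fun Omega f ->
  (forall x, Omega x -> `|f x| <= `|g x|) -> mu.-integrable Omega (EFin \o g) ->
  mu.-integrable Omega (EFin \o f).
Proof.
by move=> mf fg; apply: le_integrable => //; exact/measurable_EFinP.
Qed.

Lemma L2_mul_integrable (f g : E -> R) : L2 Omega f -> L2 Omega g ->
  mu.-integrable Omega (EFin \o (fun x => f x * g x)).
Proof.
move=> [mf if2] [mg ig2].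
apply: (@integrable_le _ (fun x => f x ^+ 2 + g x ^+ 2)).
- exact: measurable_funM.
- move=> x _; rewrite [leRHS]ger0_norm ?addr_ge0 ?sqr_ge0// ler_norml.
  have := sqr_ge0 (f x - g x); have := sqr_ge0 (f x + g x).
  have := sqr_ge0 (f x); have := sqr_ge0 (g x).
  by move=> *; apply/andP; split; lra.
- by apply: eq_integrable (integrableD mO if2 ig2) => // x _; rewrite /= EFinD.
Qed.

Lemma L2_sqr_integrable (f : E -> R) : L2 Omega f ->
  mu.-integrable Omega (EFin \o (fun x => f x * f x)).
Proof. by move=> Lf; exact: L2_mul_integrable. Qed.

Lemma L2_le (f g : E -> R) : measurable_fun Omega f ->
  (forall x, Omega x -> `|f x| <= `|g x|) -> L2 Omega g -> L2 Omega f.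
Proof.
move=> mf fg [mg ig]; split => //.
apply: (@integrable_le (fun x => f x ^+ 2) (fun x => g x ^+ 2)) => //.
  exact: measurable_funX.
by move=> x Ox; rewrite !normrX lerXn2r ?nnegrE// fg.
Qed.

Lemma L2_lin (a : R) (f g : E -> R) : L2 Omega f -> L2 Omega g ->
  L2 Omega (fun x => a * f x + g x).
Proof.
move=> Lf Lg; have [mf _] := Lf; have [mg _] := Lg; split.
  by apply: measurable_funD => //; exact: measurable_funM.
have i1 := L2_sqr_integrable Lf; have i2 := L2_mul_integrable Lf Lg.
have i3 := L2_sqr_integrable Lg.
have i1' := integrableZl mO (a ^+ 2) i1; have i2' := integrableZl mO (2 * a) i2.
apply: eq_integrable (integrableD mO (integrableD mO i1' i2') i3) => // x _ /=.
by rewrite -!EFinM -!EFinD; congr EFin; ring.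
Qed.

Lemma L2_0 : L2 Omega (fun=> 0).
Proof.
split; first exact: measurable_cst.
by apply: eq_integrable (integrable0 mu Omega) => // x _; rewrite /= expr0n.
Qed.

Lemma L2_subspace : @subspace R (E -> R^o) (L2 Omega).
Proof. by split => [|a f g Lf Lg]; [exact: L2_0|exact: L2_lin]. Qed.

Lemma L2Z (a : R) (f : E -> R) : L2 Omega f -> L2 Omega (fun x => a * f x).
Proof. by move=> Lf; exact: (subspaceZ L2_subspace a Lf). Qed.

Lemma ipC f g : ip f g = ip g f.
Proof. by apply: eq_Rintegral => x _; rewrite mulrC. Qed.

Lemma ipl a f g h : L2 Omega f -> L2 Omega g -> L2 Omega h ->
  ip (fun x => a * f x + g x) h = a * ip f h + ip g h.
Proof.
move=> Lf Lg Lh; have i1 := L2_mul_integrable Lf Lh.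
have i2 := L2_mul_integrable Lg Lh.
rewrite /ip -RintegralZl// -RintegralD//; last first.
  by apply: eq_integrable (integrableZl mO a i1).
by apply: eq_Rintegral => x _; rewrite mulrDl mulrA.
Qed.

Lemma L2_semi_inner : @semi_inner R (E -> R^o) (L2 Omega) ip.
Proof.
split; first exact: L2_subspace.
- split => a f g h Lf Lg Lh; first exact: ipl.
  by rewrite 3!(ipC h); exact: ipl.
- by move=> f g _ _; exact: ipC.
- by move=> f _; apply: Rintegral_ge0 => x _; exact: sqr_ge0.
Qed.

Lemma norm0E f : norm0 Omega f = @snorm R (E -> R) ip f.
Proof. by rewrite /norm0 /snorm /ip; under eq_Rintegral do rewrite expr2. Qed.

(** The bridge between extended-real integrals, to which Fatou's lemma applies, and the real
    seminorm; square integrability is what makes [fine] lossless. *)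
Lemma L2_integralE f : L2 Omega f ->
  (\int[mu]_(x in Omega) (f x ^+ 2)%:E = (snorm ip f ^+ 2)%:E)%E.
Proof.
move=> Lf; rewrite (sqr_snorm L2_semi_inner)//.
rewrite /ip /Rintegral fineK; last exact: integrable_fin_num (L2_sqr_integrable Lf).
by apply: eq_integral => x _; rewrite expr2.
Qed.

Lemma snorm_eq0_ae f : L2 Omega f -> snorm ip f = 0 -> ae_eq mu Omega f (cst 0).
Proof.
move=> Lf f0; have := L2_integralE Lf; rewrite f0 expr0n /=.
under eq_integral do rewrite -[(_ ^+ 2)%:E]gee0_abs ?lee_fin ?sqr_ge0//.
move=> /ae_eq_integral_abs H.
have /H : measurable_fun Omega (fun x => (f x ^+ 2)%:E).
  by apply/measurable_EFinP; apply: measurable_funX; case: Lf.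
move=> /(_ mO); apply: filterS => x /= h Ox.
by have [/eqP] := h Ox; rewrite sqrf_eq0 => /eqP.
Qed.

(** Each term is at most the finite sum, so the k-th increment is at most a constant times 2^-k, and
    the telescoping series converges. *)
Let fast_cauchy_cvg (v : nat -> E -> R) (x : E) :
  (\sum_(k <oo) (4 ^+ k * (v k.+1 x - v k x) ^+ 2)%:E < +oo)%E ->
  cvgn (v ^~ x).
Proof.
set G := (limn _) => Gfin.
have G0 : (0 <= G)%E by apply: nneseries_ge0 => k _ _; rewrite lee_fin mulr_ge0 ?sqr_ge0.
have GE : G = (fine G)%:E by rewrite fineK// ge0_fin_numE.
have bnd k : `|v k.+1 x - v k x| <= geometric (Num.sqrt (fine G)) 2^-1 k.
  rewrite /= -(@ler_pXn2r _ 2)// ?nnegrE ?mulr_ge0 ?sqrtr_ge0//.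
  rewrite exprMn sqr_sqrtr ?fine_ge0// real_normK ?num_real//.
  rewrite -exprM mulnC exprM exprVn (_ : 2 ^+ 2 = 4); last by rewrite -natrX.
  rewrite exprVn ler_pdivlMr ?exprn_gt0// mulrC -lee_fin -GE.
  apply: le_trans (nneseries_lim_ge (m := 0) (P := xpredT) k.+1 _).
    rewrite big_nat_recr//= leeDr//; apply: sume_ge0 => i _.
    by rewrite lee_fin mulr_ge0 ?sqr_ge0.
  by move=> n _ _; rewrite lee_fin mulr_ge0 ?sqr_ge0.
have : cvgn (series (telescope (v ^~ x))).
  apply: normed_cvg; apply: series_le_cvg bnd _ => //.
    by move=> n; rewrite /= mulr_ge0 ?sqrtr_ge0.
  by apply: is_cvg_geometric_series; rewrite ger0_norm// invf_lt1// ltr1n.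
move=> c; rewrite (_ : v ^~ x = (fun n => v 0%N x + series (telescope (v ^~ x)) n)).
  by apply: is_cvgD => //; exact: is_cvg_cst.
by apply/funext => n; rewrite [LHS](eq_sum_telescope (v ^~ x)).
Qed.

(* Along a subsequence [v] with [|v_(k+1) - v_k| <= 4^-k] in norm, the sum [G] of the
   [4^k (v_(k+1) - v_k)^2] is integrable, hence finite almost everywhere, and where it is
   finite [v_k] converges geometrically; Fatou's lemma makes this an L2 limit. *)
Theorem L2_complete : @complete_for R (E -> R^o) (L2 Omega) ip.
Proof.
move=> u Lu cu.
have /choice[N hN] k : exists N, forall m n, (N <= m)%N -> (N <= n)%N ->
    snorm ip (u m - u n) <= 4 ^- k.
  by apply: cu; rewrite invr_gt0 exprn_gt0.
(* The partial sums make [s] nondecreasing and at least [N k]; the summand [k] makes it at least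
   [k]. *)
pose s k := (\sum_(i < k.+1) N i + k)%N.
have sN k : (N k <= s k)%N by rewrite /s big_ord_recr/= -addnA addnCA leq_addr.
have sS k : (s k <= s k.+1)%N.
  by rewrite /s [leqRHS](_ : _ = (\sum_(i < k.+1) N i + N k.+1 + k.+1)%N)
    ?big_ord_recr//= leq_add// leq_addr.
have sk k : (k <= s k)%N by rewrite leq_addl.
pose v k := u (s k).
have Lv k : L2 Omega (v k) by exact: Lu.
pose g k x := (4 ^+ k * (v k.+1 x - v k x) ^+ 2)%:E : \bar R.
have g0 k x : (0 <= g k x)%E by rewrite lee_fin mulr_ge0 ?sqr_ge0.
have mg k : measurable_fun Omega (g k).
  apply/measurable_EFinP; apply: measurable_funM => //; apply: measurable_funX.
  by apply: measurable_funB; [case: (Lv k.+1)|case: (Lv k)].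
pose G x := (\sum_(k <oo) g k x)%E.
have mG : measurable_fun Omega G.
  by apply: ge0_emeasurable_sum => // k x _ _; exact: g0.
have G0 x : (0 <= G x)%E by apply: nneseries_ge0.
have intG : (\int[mu]_(x in Omega) G x < +oo)%E.
  rewrite integral_nneseries//.
  (* The weight 4^k against the squared distance 4^(-2k) leaves 4^-k, which is summable. *)
  have h k : (\int[mu]_(x in Omega) g k x <= (geometric 1 4^-1 k)%:E)%E.
    rewrite /g; under eq_integral do rewrite EFinM.
    rewrite ge0_integralZl_EFin//; last 2 first.
    - by move=> x _; rewrite lee_fin sqr_ge0.
    - apply/measurable_EFinP; apply: measurable_funX.
      by apply: measurable_funB; [case: (Lv k.+1)|case: (Lv k)].
    rewrite (@L2_integralE (v k.+1 - v k)); last exact: (subspaceB L2_subspace).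
    rewrite -EFinM lee_fin /= mul1r.
    have := hN k (s k.+1) (s k) (leq_trans (sN k) (sS k)) (sN k).
    rewrite -/(v _) -/(v _) => /= hk.
    have : snorm ip (v k.+1 - v k) ^+ 2 <= (4 ^- k) ^+ 2.
      by rewrite lerXn2r ?nnegrE ?snorm_ge0 ?invr_ge0 ?exprn_ge0.
    move=> /(ler_wpM2l (exprn_ge0 k (ler0n R 4))) /le_trans; apply.
    by rewrite [leRHS]exprVn expr2 mulrA divff ?mul1r// expf_neq0.
  apply: (@le_lt_trans _ _ (1 * (1 - 4^-1)^-1)%:E); last exact: ltry.
  apply: lime_le; first by apply: is_cvg_nneseries => n _ _; exact: integral_ge0.
  near=> n; apply: le_trans (_ : (series (geometric 1 4^-1) n)%:E <= _)%E.
    by rewrite /series /= -sumEFin big_mkord big_mkord; apply: lee_sum => i _; exact: h.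
  by rewrite lee_fin; apply: geometric_le_lim => //; rewrite ger0_norm// invf_lt1// ltr1n.
pose Z := Omega `&` [set x | G x = +oo%E].
have mZ : measurable Z.
  rewrite /Z (_ : [set x | _] = G @^-1` [set +oo%E])//; apply: mG => //.
have Z0 : mu Z = 0%E.
  have iG : mu.-integrable Omega G.
    apply/integrableP; split => //; under eq_integral do rewrite gee0_abs//.
    by [].
  have [A [mA A0 hA]] := integrable_ae mO iG.
  apply: (subset_measure0 mZ mA _ A0); apply: subset_trans hA => x [Ox /= Gx] /=.
  by move=> /(_ Ox); rewrite Gx.
have cv x : Omega x -> ~ Z x -> cvgn (v ^~ x).
  move=> Ox nZ; apply: fast_cauchy_cvg; rewrite ltey; apply/eqP => Gx.
  by apply: nZ; split.
(* Away from [Z] this is the pointwise limit; on [Z] it is the constant default of the restriction,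
   so that it is a limit of measurable functions at every point of [Omega]. *)
pose w : E -> R := (fun x => limn (v ^~ x)) \_ (~` Z).
have wcv x : Omega x -> ~ Z x -> v ^~ x @ \oo --> w x.
  by move=> Ox nZ; rewrite /w patchE mem_set//; exact: cv.
have mw : measurable_fun Omega w.
  apply: (@measurable_fun_cvg _ _ _ _ (fun k => v k \_ (~` Z))).
    move=> k; apply/measurable_restrict => //; first exact: measurableC.
    by apply: measurable_funS (proj1 (Lv k)) => //; exact: subIsetl.
  move=> x Ox; have [xZ|xZ] := pselect (Z x).
    by rewrite /w patchE memNset//=; under eq_fun do rewrite patchE memNset//; exact: cvg_cst.
  under eq_fun do rewrite patchE mem_set//; exact: wcv.
(* Fatou's lemma for the squares of [v (k + K) - u m]; the shift by [K] makes each of these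
   integrals at most [e ^+ 2]. *)
have key (e : R) m : 0 <= e -> (exists K, forall k, (K <= k)%N -> snorm ip (v k - u m) <= e) ->
    (\int[mu]_(x in Omega) ((w x - u m x) ^+ 2)%:E <= (e ^+ 2)%:E)%E.
  move=> e0 [K hK]; have [mum _] := Lu m.
  rewrite (ge0_negligible_integral mZ)//; last 2 first.
  - apply/measurable_EFinP; apply: measurable_funX; exact: measurable_funB.
  - by move=> x _; rewrite lee_fin sqr_ge0.
  have mOZ : measurable (Omega `\` Z) by exact: measurableD.
  pose f k x := ((v (k + K)%N x - u m x) ^+ 2)%:E : \bar R.
  have mf k : measurable_fun Omega (f k).
    apply/measurable_EFinP; apply: measurable_funX; apply: measurable_funB => //.
    by case: (Lv (k + K)%N).
  have mfZ k : measurable_fun (Omega `\` Z) (f k).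
    by apply: measurable_funS (mf k) => //; exact: subDsetl.
  have f0 k x : (Omega `\` Z) x -> (0 <= f k x)%E by rewrite lee_fin sqr_ge0.
  have -> : (\int[mu]_(x in Omega `\` Z) ((w x - u m x) ^+ 2)%:E =
      \int[mu]_(x in Omega `\` Z) limn_einf (f ^~ x))%E.
    apply: eq_integral => x /set_mem[Ox nZ]; apply/esym.
    apply: (fst (cvg_limn_einf_sup _)); apply: cvg_EFin; first exact: nearW.
    have h : v (k + K)%N x - u m x @[k --> \oo] --> w x - u m x.
      apply: cvgB; last exact: cvg_cst.
      by rewrite (cvg_shiftn K (v ^~ x)); exact: wcv.
    exact: (cvgM h h).
  apply: (le_trans (fatou mu mOZ mfZ f0)).
  rewrite limn_einf_lim; apply: lime_le; first exact: is_cvg_einfs.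
  apply: nearW => k; apply: le_trans (_ : \int[mu]_(x in Omega `\` Z) f k x <= _)%E.
    by apply: ereal_inf_lbound; exists k => /=.
  apply: (@le_trans _ _ (\int[mu]_(x in Omega) f k x)%E).
    by apply: ge0_subset_integral => // x _; rewrite lee_fin sqr_ge0.
  rewrite (@L2_integralE (v (k + K)%N - u m)); last exact: (subspaceB L2_subspace).
  by rewrite lee_fin lerXn2r ?nnegrE ?snorm_ge0//; apply: hK; rewrite leq_addl.
(* Comparison with every late [u m], not just with the subsequence, gives convergence of the whole
   sequence. *)
have unif (e : R) : 0 < e -> exists M, forall m, (M <= m)%N ->
    (\int[mu]_(x in Omega) ((w x - u m x) ^+ 2)%:E <= (e ^+ 2)%:E)%E.
  move=> e0; have [M hM] := cu _ e0; exists M => m Mm.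
  apply: key; first exact: ltW.
  by exists M => k Mk; apply: hM => //; exact: leq_trans Mk (sk k).
have Ldiff m : (\int[mu]_(x in Omega) ((w x - u m x) ^+ 2)%:E < +oo)%E ->
    L2 Omega (fun x => w x - u m x).
  move=> h; have mwu : measurable_fun Omega (fun x => w x - u m x).
    by apply: measurable_funB => //; case: (Lu m).
  split => //; apply/integrableP; split.
    by apply/measurable_EFinP; exact: measurable_funX.
  by under eq_integral do rewrite gee0_abs ?lee_fin ?sqr_ge0//.
have Lw : L2 Omega w.
  have [M hM] := unif 1 ltr01.
  have LM : L2 Omega (fun x => w x - u M x).
    by apply: Ldiff; apply: le_lt_trans (hM M (leqnn _)) _; exact: ltry.
  have := L2_lin 1 LM (Lu M); congr (L2 _ _).
  by apply/funext => x; rewrite mul1r subrK.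
exists w => // e e0; have [M hM] := unif _ e0; exists M => n Mn.
rewrite (snormBC L2_semi_inner)//.
have := hM n Mn; rewrite (@L2_integralE (w - u n)); last exact: (subspaceB L2_subspace).
by rewrite lee_fin ler_pXn2r// ?nnegrE ?snorm_ge0// ltW.
Unshelve. all: by end_near.
Qed.

End L2_theory.

(** * Derivatives and test functions *)

Lemma dist_split (R : realFieldType) (a b m e : R) :
  `|a - m| < e / 2 -> `|b - m| < e / 2 -> `|a - b| <= e.
Proof.
move=> h1 h2; rewrite (_ : a - b = (a - m) - (b - m)); last by ring.
by rewrite (le_trans (ler_normB _ _))//; lra.
Qed.

Section directional_derivative.
Context (R : realType) (V : normedModType R).
Implicit Types (f : V -> R) (u v x : V).

Lemma is_derive_line f x v (t : R) : derivable f (x + t *: v) v ->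
  is_derive t 1 (fun s => f (x + s *: v)) ('D_v f (x + t *: v)).
Proof.
move=> df.
have E : (fun h : R => h^-1 *: (((fun s => f (x + s *: v)) \o shift t) (h *: 1)
      - f (x + t *: v))) =
    (fun h : R => h^-1 *: ((f \o shift (x + t *: v)) (h *: v) - f (x + t *: v))).
  apply/funext => h /=; congr (_ *: (f _ - _)).
  by rewrite scalerDl -scalerA scale1r addrCA.
by split; [rewrite /derivable E|rewrite /derive E].
Qed.

Lemma line_continuous x v : continuous (fun t : R => x + t *: v).
Proof.
move=> t; apply: cvgD; first exact: cvg_cst.
by apply: cvgZr_tmp; exact: cvg_id.
Qed.

Lemma derive_line_MVT f x v (h : R) : (forall y, derivable f y v) -> 0 < h ->
  exists2 t, 0 < t < h & f (x + h *: v) - f x = h * 'D_v f (x + t *: v).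
Proof.
move=> df h0; have dl t := is_derive_line (df (x + t *: v)).
have [|t] := MVT h0 (fun t _ => dl t).
  by apply: derivable_within_continuous => t _; case: (dl t).
rewrite in_itv /= => th; rewrite scale0r addr0 subr0 mulrC => E.
by exists t.
Qed.

(** The mean value theorem twice: first in direction [u] for the difference [g] of [f] along
    [h *: v], then in direction [v] for the derivative of [f] along [u]. *)
Let mean2 f x u v (h : R) :
  (forall y, derivable f y u) -> (forall y, derivable ('D_u f) y v) -> 0 < h ->
  exists s t : R, [/\ 0 < s < h, 0 < t < h &
    f (x + h *: u + h *: v) - f (x + h *: u) - f (x + h *: v) + f x =
    h ^+ 2 * 'D_v ('D_u f) (x + s *: u + t *: v)].
Proof.
move=> du duv h0.
pose g y := f (y + h *: v) - f y.
have dg y : is_derive y u g ('D_u f (y + h *: v) - 'D_u f y).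
  apply: is_deriveB; last exact: derivableP.
  have E : (fun k : R => k^-1 *: (((fun z => f (z + h *: v)) \o shift y) (k *: u)
      - f (y + h *: v))) =
    (fun k : R => k^-1 *: ((f \o shift (y + h *: v)) (k *: u) - f (y + h *: v))).
    by apply/funext => k /=; rewrite addrA.
  split; first by rewrite /derivable E; exact: du.
  by rewrite /derive E.
have [s sh gE] := derive_line_MVT x (fun y => @ex_derive _ _ _ _ _ _ _ (dg y)) h0.
have [t th fE] := derive_line_MVT (x + s *: u) duv h0.
exists s, t; split => //.
rewrite expr2 -mulrA -fE -(@derive_val _ _ _ _ _ _ _ (dg (x + s *: u))) -gE /g.
by rewrite opprB [x + _ + h *: v]addrAC addrA addrAC; ring.
Qed.

(* Schwarz: both mixed derivatives are limits of the same second difference quotient. *)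
Lemma derive_comm f u v x :
  (forall y, derivable f y u) -> (forall y, derivable f y v) ->
  (forall y, derivable ('D_u f) y v) -> (forall y, derivable ('D_v f) y u) ->
  {for x, continuous ('D_v ('D_u f))} -> {for x, continuous ('D_u ('D_v f))} ->
  'D_v ('D_u f) x = 'D_u ('D_v f) x.
Proof.
move=> du dv duv dvu cuv cvu.
apply/eqP; rewrite -subr_eq0; apply/eqP/eq0_small => e e0.
have e20 : 0 < e / 2 by lra.
have /cvgrPdist_lt/(_ _ e20)/nbhs_normP[r1 /= r10 h1] := cuv.
have /cvgrPdist_lt/(_ _ e20)/nbhs_normP[r2 /= r20 h2] := cvu.
(* A point [x + s *: u + t *: v] with [s, t < h] is at distance less than [h * D] from [x]; the
   [+ 1] keeps [D] positive when both directions vanish. *)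
pose D := `|u| + `|v| + 1.
have D0 : 0 < D by rewrite /D; have := normr_ge0 u; have := normr_ge0 v; lra.
have [h h0 hD] : exists2 h : R, 0 < h & Num.min r1 r2 = h * D.
  by exists (Num.min r1 r2 / D); rewrite ?divr_gt0 ?lt_min ?r10// divfK ?gt_eqF.
have near_x (s t : R) u' v' : 0 < s < h -> 0 < t < h -> `|u'| + `|v'| + 1 = D ->
    `|x - (x + s *: u' + t *: v')| < Num.min r1 r2.
  move=> /andP[s0 sh] /andP[t0 th] DE.
  rewrite -addrA opprD addrA subrr sub0r normrN.
  rewrite (le_lt_trans (ler_normD _ _))// !normrZ !gtr0_norm//.
  rewrite hD -DE.
  have := ler_wpM2r (normr_ge0 u') (ltW sh).
  have := ler_wpM2r (normr_ge0 v') (ltW th).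
  lra.
have [s [t [sh th E1]]] := mean2 x du duv h0.
have [t' [s' [th' sh' E2]]] := mean2 x dv dvu h0.
have E : 'D_v ('D_u f) (x + s *: u + t *: v) = 'D_u ('D_v f) (x + t' *: v + s' *: u).
  apply: (mulfI (lt0r_neq0 (exprn_gt0 2 h0))).
  move: E1 E2; rewrite [x + h *: v + _]addrAC.
  move=> E1 E2; apply: (etrans (esym E1)); apply: (etrans _ E2).
  by congr (_ + _); exact: addrAC.
have := h1 (x + s *: u + t *: v); have := h2 (x + t' *: v + s' *: u).
have := near_x s t u v sh th erefl.
have := near_x t' s' v u th' sh'; rewrite [`|v| + _]addrC => /(_ erefl).
rewrite /= !lt_min => /andP[_ n2] /andP[n1 _] /(_ n2) h3 /(_ n1) h4.
rewrite E in h4.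
exact: (dist_split h4 h3).
Qed.

End directional_derivative.

(** * Calculus of smooth and test functions *)

Section test_functions.
Context (R : realType) (d : nat).
Local Notation E := 'rV[R]_d.
Implicit Types (f g : E -> R) (Omega : set E).

(** In [foldr partial f s] the innermost derivative is the last entry of [s], whence [rcons]. *)
Lemma smooth_partial i f : smooth f -> smooth (partial i f).
Proof.
by move=> sf s; have := sf (rcons s i); rewrite foldr_rcons.
Qed.

Lemma smooth_continuous f : smooth f -> continuous f.
Proof. by move=> sf; have [] := sf [::]. Qed.

Lemma smooth_derivable f i x : smooth f -> derivable f x (delta_mx ord0 i).
Proof. by move=> sf; have [_] := sf [::]; exact. Qed.

Lemma partial_lin a i f g x :
  derivable f x (delta_mx ord0 i) -> derivable g x (delta_mx ord0 i) ->
  partial i (fun x => a * f x + g x) x = a * partial i f x + partial i g x.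
Proof.
move=> df dg; rewrite /partial.
have := deriveD (@derivableZ _ _ _ f a x _ df) dg.
by rewrite (@deriveZ _ _ _ f a x _ df); exact.
Qed.

Lemma smooth_lin a f g : smooth f -> smooth g -> smooth (fun x => a * f x + g x).
Proof.
move=> sf sg s.
have -> : foldr partial (fun x => a * f x + g x) s =
    (fun x => a * foldr partial f s x + foldr partial g s x).
  elim: s => //= i s ->; apply/funext => x; apply: partial_lin.
    by have [_] := sf s; exact.
  by have [_] := sg s; exact.
have [cf df] := sf s; have [cg dg] := sg s; split.
  by move=> x; apply: continuousD (cg x); apply: continuousM (cf x); exact: cst_continuous.
move=> i x; apply: derivableD (dg i x).
exact: (@derivableZ _ _ _ (foldr partial f s) a x _ (df i x)).
Qed.

Lemma partial_comm i j f : smooth f -> partial i (partial j f) = partial j (partial i f).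
Proof.
move=> sf; have si := smooth_partial i sf; have sj := smooth_partial j sf.
apply/funext => x; apply: derive_comm => [y|y|y|y||].
- exact: smooth_derivable.
- exact: smooth_derivable.
- exact: (smooth_derivable sj).
- exact: (smooth_derivable si).
- exact: (smooth_continuous (smooth_partial i sj)).
- exact: (smooth_continuous (smooth_partial j si)).
Qed.

(** Off the closed support [f] vanishes on a whole neighbourhood, so it has the germ of a
    constant. *)
Lemma partial_off_support i f x : ~ closure [set x | f x != 0] x -> partial i f x = 0.
Proof.
move=> nx; rewrite /partial (@near_eq_derive _ _ _ f (cst 0)) ?derive_cst//.
have /existsNP[B /not_implyP[nB AB]] := nx.
apply: filterS nB => y By; apply/eqP/negP => /negP fy.
by apply: AB; exists y.
Qed.

Lemma test_function_partial Omega i f : test_function Omega f ->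
  test_function Omega (partial i f).
Proof.
move=> [sf kf fO].
have sub : closure [set x | partial i f x != 0] `<=` closure [set x | f x != 0].
  rewrite [X in _ `<=` X](closure_id _).1; last exact: closed_closure.
  by apply: closureS => x /= h; apply: contrapT => /(partial_off_support i)/eqP; rewrite (negbTE h).
split; first exact: smooth_partial.
- apply: (subclosed_compact _ kf sub); exact: closed_closure.
- exact: (subset_trans sub).
Qed.

Lemma test_function_lin Omega a f g : test_function Omega f -> test_function Omega g ->
  test_function Omega (fun x => a * f x + g x).
Proof.
move=> [sf kf fO] [sg kg gO].
have sub : closure [set x | a * f x + g x != 0] `<=`
    closure [set x | f x != 0] `|` closure [set x | g x != 0].
  rewrite -closureU; apply: closureS => x /= h.
  have [f0|f0] := eqVneq (f x) 0; last by left.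
  by right; move: h; rewrite f0 mulr0 add0r.
split; first exact: smooth_lin.
- apply: subclosed_compact sub; [exact: closed_closure|exact: compactU].
- by apply: (subset_trans sub) => x [/fO|/gO].
Qed.

Lemma test_function_off Omega f x : test_function Omega f -> ~ Omega x -> f x = 0.
Proof.
move=> [_ _ fO] nx; apply/eqP/negP => /negP fx; apply/nx/fO.
exact: subset_closure.
Qed.

End test_functions.

(** * Product measurability and integration of partial derivatives *)

Section measure_rV.
Context (R : realType).

Lemma coord_le_norm n (x : 'rV[R]_n) i : `|x ord0 i| <= `|x|.
Proof.
rewrite [leRHS](mx_normrE x).
by apply: (le_trans _ (le_bigmax _ _ (ord0, i))).
Qed.

(** The sigma-algebra is generated by the coordinates, not by the open sets. The norm is the maximum
    norm, so its balls are boxes, and an open set is the countable union of the rational boxes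
    inside it. *)
Lemma open_measurable_rV n (U : set 'rV[R]_n) : open U -> measurable U.
Proof.
move=> oU.
pose B (p : 'rV[rat]_n * rat) := [set y : 'rV[R]_n |
  forall i, `]ratr (p.1 ord0 i) - ratr p.2, ratr (p.1 ord0 i) + ratr p.2[%classic (y ord0 i)].
pose F p := if `[< B p `<=` U >] then B p else set0.
have -> : U = \bigcup_p F p.
  apply/seteqP; split => x; last first.
    by move=> [p _]; rewrite /F; case: asboolP => // sub /sub.
  move=> Ux; have /nbhs_ballP[e /= e0 xU] : nbhs x U by exact: open_nbhs_nbhs.
  (* The box has half-width [r] and a centre within [r] of [x]; [r < e / 2] keeps it inside the ball
     of radius [e]. *)
  have [|r] := @rat_in_itvoo _ (0 : R) (e / 2); first by lra.
  rewrite in_itv /= => /andP[r0 re].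
  have /choice[q hq] i : exists q : rat, x ord0 i - ratr r < ratr q < x ord0 i + ratr r.
    have [|q] := @rat_in_itvoo _ (x ord0 i - ratr r) (x ord0 i + ratr r); first by lra.
    by rewrite in_itv; exists q.
  exists (\row_i q i, r) => //; rewrite /F.
  have xB : B (\row_i q i, r) x.
    by move=> i; rewrite /= mxE in_itv /=; have /andP[h1 h2] := hq i; apply/andP; split; lra.
  case: asboolP => // -[] y By; apply: xU; split => // i j.
  rewrite (ord1 i); have := By j; have := hq j.
  rewrite /= mxE in_itv /= /ball /= ltr_norml => /andP[h1 h2] /andP[h3 h4].
  by apply/andP; split; lra.
apply: countable_bigcupT_measurable => // p; rewrite /F; case: asboolP => // _.
apply: (@measurable_box _ _
  (fun i => `]ratr (p.1 ord0 i) - ratr p.2, ratr (p.1 ord0 i) + ratr p.2[%classic)) => i.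
exact: measurable_itv.
Qed.


Lemma continuous_measurable_rV n (f : 'rV[R]_n -> R) : continuous f ->
  measurable_fun setT f.
Proof.
move=> /continuousP cf; apply: (measurability _ (RGenOpens.measurableE R)).
move=> _ [_ [a [b ->] <-]]; rewrite setTI; apply: open_measurable_rV.
exact/cf/interval_open.
Qed.

Lemma bounded_finite_measure n (D : set 'rV[R]_n) (L : R) : measurable D ->
  (forall x, D x -> `|x| <= L) -> (lebesgue_rV n D < +oo)%E.
Proof.
move=> mD DL; pose B := [set x : 'rV[R]_n | forall i, `[- L, L]%classic (x ord0 i)].
have mB : measurable B.
  by apply: (@measurable_box _ _ (fun=> `[- L, L]%classic)) => i; exact: measurable_itv.
apply: (@le_lt_trans _ _ (lebesgue_rV n B)).
  apply: le_measure; rewrite ?inE// => x Dx i.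
  by rewrite /= in_itv /= -ler_norml (le_trans (coord_le_norm _ _))// DL.
rewrite (lebesgue_rV_box (A := fun=> `[- L, L]%classic)).
  by rewrite ltey_eq; apply/orP; left; elim/big_ind: _ => // [x y|i _];
    [exact: fin_numM|rewrite lebesgue_measure_itv /=; case: ifP].
by move=> i; exact: measurable_itv.
Qed.

Lemma norm_gt_open (V : normedModType R) (L : R) : open [set x : V | L < `|x|].
Proof. by have /continuousP/(_ _ (@open_gt _ L)) := @norm_continuous R V; exact. Qed.

Lemma closed_ball0_measurable n (L : R) : measurable [set x : 'rV[R]_n | `|x| <= L].
Proof.
have -> : [set x : 'rV[R]_n | `|x| <= L] = ~` [set x | L < `|x|].
  by apply/seteqP; split => x /=; rewrite leNgt => /negP.
apply: measurableC; apply: open_measurable_rV; exact: norm_gt_open.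
Qed.

Lemma bounded_integrable n (D : set 'rV[R]_n) (f : 'rV[R]_n -> R) (L K : R) :
  measurable D -> (forall x, D x -> `|x| <= L) -> measurable_fun D f ->
  (forall x, D x -> `|f x| <= K) -> (lebesgue_rV n).-integrable D (EFin \o f).
Proof.
move=> mD DL mf fK; apply: measurable_bounded_integrable => //.
  exact: bounded_finite_measure DL.
exists K; split; rewrite ?num_real// => k Kk x Dx /=.
by apply: le_trans (ltW Kk); exact: fK.
Qed.

Section integral_partial.
Context (n : nat) (h : 'rV[R]_n.+1 -> R) (L : R).
Local Notation e0 := (delta_mx ord0 ord0 : 'rV[R]_n.+1).
Hypothesis dh : forall x, derivable h x e0.
Hypothesis ch : continuous (partial ord0 h).
Hypothesis h0 : forall x, L < `|x| -> h x = 0.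

Let dh0 x : L < `|x| -> partial ord0 h x = 0.
Proof.
move=> Lx; apply: partial_off_support => /(_ [set y | L < `|y|]) [].
  apply: open_nbhs_nbhs; split => //.
  exact: norm_gt_open.
by move=> y /= [hy] /h0 /eqP; rewrite (negbTE hy).
Qed.

Let B := [set x : 'rV[R]_n.+1 | `|x| <= L].

(** Off the ball the derivative vanishes, and on it continuity and compactness give a bound. This
    integrability is what Fubini's theorem asks for. *)
Let integrable_partial :
  (lebesgue_rV n.+1).-integrable setT (EFin \o partial ord0 h).
Proof.
have mB : measurable B by exact: closed_ball0_measurable.
have -> : EFin \o partial ord0 h = (EFin \o partial ord0 h) \_ B.
  apply/funext => x; rewrite patchE; case: ifPn => // /negP xB /=.
  by rewrite dh0// ltNge; apply/negP => xL; apply: xB; rewrite inE.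
apply/(integrable_mkcond _ mB).
have [K hK] : exists K, forall x, B x -> `|partial ord0 h x| <= K.
  have cB : compact B.
    apply: bounded_closed_compact.
      by exists L; split; rewrite ?num_real// => k Lk x Bx /=; apply: le_trans (ltW Lk).
    rewrite (_ : B = ~` [set x | L < `|x|]).
      exact/open_closedC/norm_gt_open.
    by apply/seteqP; split => x /=; rewrite /B /= leNgt => /negP.
  have : compact (partial ord0 h @` B).
    by apply: continuous_compact => //; apply: continuous_subspaceT => x; exact: ch.
  move=> /compact_bounded[K [_ hK]]; exists (K + 1) => x Bx.
  by apply: (hK (K + 1)); [rewrite ltrDl|exists x].
apply: (bounded_integrable mB (L := L) (K := K)) => //.
by apply: measurable_funTS; exact: continuous_measurable_rV.
Qed.

(** On a line parallel to the first axis the integrand is the derivative of [h], which vanishes at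
    both ends of a long enough interval. *)
Let slice (y : 'rV[R]_n) :
  (\int[@lebesgue_measure R]_t (partial ord0 h (rVcons (t, y)))%:E = 0)%E.
Proof.
pose x0 := rVcons (0 : measurableTypeR R, y).
have lineE (t : R) : rVcons (t : measurableTypeR R, y) = x0 + t *: e0.
  apply/rowP => i; rewrite !mxE /=; case: unliftP => [j ->|->] /=.
    by rewrite mulr0 addr0.
  by rewrite mulr1 add0r.
have far (t : R) : L < `|t| -> L < `|x0 + t *: e0|.
  move=> Lt; rewrite (lt_le_trans Lt)// -lineE.
  by have := coord_le_norm (rVcons (t : measurableTypeR R, y)) ord0; rewrite mxE unlift_none.
(* Both [M] and [- M] lie strictly beyond [L] in absolute value, whatever the sign of [L]. *)
pose M : R := `|L| + 1.
have LM : L < M by rewrite /M; have := ler_norm L; lra.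
have M0 : 0 < M by rewrite /M; have := normr_ge0 L; lra.
have dl t := is_derive_line (@dh (x0 + t *: e0)).
have cl : continuous (fun t : R => partial ord0 h (x0 + t *: e0)).
  move=> t; apply: (@continuous_comp _ _ _ (fun t : R => x0 + t *: e0) (partial ord0 h)).
    exact: line_continuous.
  exact: ch.
have chl : continuous (fun t : R => h (x0 + t *: e0)).
  by move=> t; apply/differentiable_continuous/derivable1_diffP; case: (dl t).
transitivity (\int[@lebesgue_measure R]_(t in `[(- M)%R, M])
    (partial ord0 h (x0 + t *: e0)%R)%:E)%E.
  rewrite [RHS]integral_mkcond; apply: eq_integral => t _.
  rewrite patchE lineE; case: ifPn => // /negP tM; rewrite dh0//; apply: far.
  rewrite (lt_trans LM)// ltNge ler_norml; apply/negP => tM'.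
  by apply: tM; rewrite inE /= in_itv.
rewrite (@continuous_FTC2 _ _ (fun t : R => h (x0 + t *: e0))).
- rewrite !h0 ?subee//; apply: far; rewrite ?normrN gtr0_norm//.
- lra.
- exact: continuous_subspaceT.
- split.
  + by move=> t _; case: (dl t).
  + by apply: cvg_at_right_filter; exact: chl.
  + by apply: cvg_at_left_filter; exact: chl.
- by move=> t _; rewrite derive1E; case: (dl t).
Qed.

(** Fubini's theorem with the first coordinate innermost, which is the one split off by [rVcons];
    every slice contributes zero. *)
Lemma integral_partial_eq0 : \int[lebesgue_rV n.+1]_x partial ord0 h x = 0.
Proof.
rewrite /Rintegral /= /lebesgue_cons.
have mh : measurable_fun setT (EFin \o partial ord0 h).
  by apply/measurable_EFinP; exact: continuous_measurable_rV.
have mc := @measurable_rVcons R n.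
have ih : (lebesgue_measure \x lebesgue_rV n)%E.-integrable setT
    ((EFin \o partial ord0 h) \o @rVcons R n).
  apply/integrableP; split; first exact: measurableT_comp.
  have /integrableP[_] := integrable_partial.
  rewrite /= /lebesgue_cons ge0_integral_pushforward//.
  by apply/measurable_EFinP; apply: measurableT_comp => //; exact: continuous_measurable_rV.
rewrite integral_pushforward//.
rewrite preimage_setT -integral21_prod_meas1//.
rewrite /fubini_G; under eq_integral do rewrite /= slice.
by rewrite integral0.
Qed.

End integral_partial.

End measure_rV.

(** * Friedrichs' inequality for test functions *)

Section friedrichs.
Context (R : realType).

Lemma is_derive_coord0 n (x : 'rV[R]_n.+1) :
  is_derive x (delta_mx ord0 ord0) (fun y : 'rV[R]_n.+1 => y ord0 ord0) 1.
Proof.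
have H : (fun h : R => h^-1 *: (((fun y : 'rV[R]_n.+1 => y ord0 ord0) \o shift x)
    (h *: delta_mx ord0 ord0) - x ord0 ord0)) @ 0^' --> (1 : R).
  apply: cvg_near_cst; near=> h.
  rewrite /= !mxE eqxx mulr1 addrK -[_ *: _]/(h^-1 * h) mulVf//.
  by near: h; exact: nbhs_dnbhs_neq.
by split; [exact: cvgP H|exact: cvg_lim H].
Unshelve. all: by end_near. Qed.

Context (d : nat) (Omega : set 'rV[R]_d) (L : R).
Hypothesis mO : measurable Omega.
Hypothesis OL : forall x, Omega x -> `|x| <= L.
Local Notation mu := (@lebesgue_rV R d).

Lemma bounded_L2 (f : 'rV[R]_d -> R) (K : R) : measurable_fun Omega f ->
  (forall x, Omega x -> `|f x| <= K) -> L2 Omega f.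
Proof.
move=> mf fK; split => //.
apply: (bounded_integrable mO OL (f := fun x => f x ^+ 2) (K := K ^+ 2)).
  exact: measurable_funX.
move=> x Ox; rewrite normrX lerXn2r ?nnegrE ?fK//.
exact: le_trans (fK _ Ox).
Qed.

Lemma test_function_L2 phi : test_function Omega phi -> L2 Omega phi.
Proof.
move=> [sf kf fO]; have cf := smooth_continuous sf.
have : compact (phi @` closure [set x | phi x != 0]).
  by apply: continuous_compact => //; apply: continuous_subspaceT => x; exact: cf.
move=> /compact_bounded[K [_ hK]].
apply: (@bounded_L2 _ (`|K| + 1)).
  by apply: measurable_funTS; exact: continuous_measurable_rV.
move=> x _; have [->|f0] := eqVneq (phi x) 0; first by rewrite normr0 addr_ge0.
apply: (hK (`|K| + 1)); first by rewrite (le_lt_trans (ler_norm K))// ltrDl.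
by exists x => //; exact: subset_closure.
Qed.

End friedrichs.

(* Integrate [d_0 (x_0 phi^2) = phi^2 + 2 x_0 phi d_0 phi] and absorb the cross term. *)
Lemma friedrichs (R : realType) n (Omega : set 'rV[R]_n.+1) (L : R) phi :
  measurable Omega -> (forall x, Omega x -> `|x| <= L) -> test_function Omega phi ->
  ip Omega phi phi <= 4 * L ^+ 2 * ip Omega (partial ord0 phi) (partial ord0 phi).
Proof.
move=> mO OL tphi; have [sphi _ _] := tphi.
have tdphi := test_function_partial ord0 tphi.
have Lphi := test_function_L2 mO OL tphi.
have Ldphi := test_function_L2 mO OL tdphi.
pose h : 'rV[R]_n.+1 -> R := (fun x : 'rV[R]_n.+1 => x ord0 ord0 : R) * (phi * phi).
pose dh x := phi x * phi x + 2 * (x ord0 ord0 * partial ord0 phi x * phi x).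
have dhP x : is_derive x (delta_mx ord0 ord0) h (dh x).
  have d1 := derivableP (smooth_derivable (i := ord0) (x := x) sphi).
  apply: (is_derive_eq (is_deriveM (is_derive_coord0 x) (is_deriveM d1 d1))).
  change (x ord0 ord0 * (phi x * partial ord0 phi x + phi x * partial ord0 phi x) +
    phi x * phi x * 1 = dh x).
  by rewrite /dh; ring.
have dhE : partial ord0 h = dh by apply/funext => x; case: (dhP x).
have cphi := smooth_continuous sphi.
have cdphi := smooth_continuous (smooth_partial ord0 sphi).
have c0 : continuous (fun x : 'rV[R]_n.+1 => x ord0 ord0 : R).
  exact: coord_continuous.
have off x : ~ Omega x -> dh x = 0.
  by move=> nx; rewrite /dh !(test_function_off tphi nx)// !mulr0 addr0.
have := @integral_partial_eq0 _ _ h L (fun x => @ex_derive _ _ _ _ _ _ _ (dhP x)).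
rewrite dhE => I0.
(* [dh] vanishes off [Omega], so the integral over the whole space is one over [Omega]. *)
have {}I0 : \int[lebesgue_rV n.+1]_(x in Omega) dh x = 0.
  rewrite Rintegral_mkcond -[RHS]I0.
  - apply: eq_Rintegral => x _; rewrite patchE; case: ifPn => // /negP xO.
    by rewrite off// => Ox; apply: xO; rewrite inE.
  - move=> x; have c2 : {for x, continuous (fun=> 2 : R)} by exact: cst_continuous.
    exact: (continuousD (continuousM (cphi x) (cphi x))
      (continuousM c2 (continuousM (continuousM (c0 x) (cdphi x)) (cphi x)))).
  - move=> x Lx; rewrite /h /= /GRing.mul /=.
    by rewrite (test_function_off tphi) ?mulr0// => /OL; rewrite leNgt Lx.
have Lxd : L2 Omega (fun x => x ord0 ord0 * partial ord0 phi x).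
  apply: (@L2_le _ _ _ mO _ (fun x => L * partial ord0 phi x)).
  - apply: measurable_funM; last by case: Ldphi.
    by apply: measurable_funTS; exact: continuous_measurable_rV.
  - move=> x Ox; rewrite !normrM ler_wpM2r// (le_trans (coord_le_norm _ _))//.
    by rewrite (le_trans (OL _ Ox))// ler_norm.
  - exact: L2Z.
have ixd := L2_mul_integrable mO Lxd Lphi.
have ip1 := L2_mul_integrable mO Lphi Lphi.
have ip2 := L2_mul_integrable mO Ldphi Ldphi.
have i2xd := integrableZl mO 2 ixd.
have i2p2 := integrableZl mO (2 * L ^+ 2) ip2.
have ihalf := integrableZl mO 2^-1 ip1.
have idh : (lebesgue_rV n.+1).-integrable Omega (EFin \o dh).
  by apply: eq_integrable (integrableD mO ip1 i2xd).
suff : 2^-1 * ip Omega phi phi <= 0 + 2 * L ^+ 2 * ip Omega (partial ord0 phi) (partial ord0 phi).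
  lra.
rewrite -I0 /ip -!RintegralZl// -RintegralD//.
apply: le_Rintegral => //.
  by apply: eq_integrable (integrableD mO idh i2p2).
move=> x Ox; rewrite /dh.
have h1 : (x ord0 ord0 * partial ord0 phi x) ^+ 2 <= L ^+ 2 * partial ord0 phi x ^+ 2.
  rewrite exprMn ler_wpM2r ?sqr_ge0// -real_normK ?num_real//.
  by rewrite lerXn2r ?nnegrE// ?(le_trans _ (OL _ Ox))// coord_le_norm.
(* Half of this square is [phi^2 / 2 + 2 x_0 phi d_0 phi + 2 (x_0 d_0 phi)^2], and the last term is
   at most [2 L^2 (d_0 phi)^2]. *)
have := sqr_ge0 (phi x + 2 * (x ord0 ord0 * partial ord0 phi x)).
move: h1; rewrite !expr2; move: (x ord0 ord0) (phi x) (partial ord0 phi x) => a b c.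
nra.
Qed.

(** * Finite families of square integrable functions *)

Section L2_family.
Context (R : realType) (d : nat) (Omega : set 'rV[R]_d) (mO : measurable Omega).
Local Notation E := 'rV[R]_d.
Local Notation mu := (@lebesgue_rV R d).
Local Notation ip := (ip Omega).

(** Integrability and value are proved together because additivity at each step needs the partial
    sum to be integrable. *)
Lemma Rintegral_sum (I : Type) (s : seq I) (F : I -> E -> R) :
  (forall i, mu.-integrable Omega (EFin \o F i)) ->
  mu.-integrable Omega (EFin \o (fun x => \sum_(i <- s) F i x)) /\
  \int[mu]_(x in Omega) (\sum_(i <- s) F i x) = \sum_(i <- s) \int[mu]_(x in Omega) F i x.
Proof.
move=> iF; elim: s => [|i s [iS IH]].
  have -> : (fun x : E => \sum_(i <- [::]) F i x) = (fun=> 0).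
    by apply/funext => x; rewrite big_nil.
  rewrite big_nil; split; first exact: integrable0.
  by rewrite Rintegral_cst// mul0r.
have -> : (fun x : E => \sum_(j <- i :: s) F j x) = (fun x => F i x + \sum_(j <- s) F j x).
  by apply/funext => x; rewrite big_cons.
rewrite big_cons -IH; split; last exact: RintegralD.
by apply: eq_integrable (integrableD mO (iF i) iS).
Qed.

Context (I : finType).
Implicit Types w z : I -> E -> R^o.

Definition L2_family : set (I -> E -> R^o) := [set w | forall i, L2 Omega (w i)].

Definition ip_family w z : R := \sum_i ip (w i) (z i).

Lemma L2_family_subspace : subspace L2_family.
Proof.
split => [i|a w z Lw Lz i]; first exact: L2_0.
exact: L2_lin.
Qed.

Lemma L2_family_semi_inner : semi_inner L2_family ip_family.
Proof.
split; first exact: L2_family_subspace.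
- split => a w z t Lw Lz Lt; rewrite /ip_family mulr_sumr -big_split /=;
    apply: eq_bigr => i _.
    exact: ipl.
  by rewrite 3!(ipC _ (t i)); exact: ipl.
- by move=> w z _ _; apply: eq_bigr => i _; exact: ipC.
- move=> w Lw; apply: sumr_ge0 => i _.
  exact: (semi_inner_ge0 (L2_semi_inner mO) (Lw i)).
Qed.

Lemma snorm_component w i : L2_family w -> snorm ip (w i) <= snorm ip_family w.
Proof.
move=> Lw; rewrite ler_wsqrtr// /ip_family (bigD1 i)//= lerDl sumr_ge0// => j _.
exact: (semi_inner_ge0 (L2_semi_inner mO) (Lw j)).
Qed.

Lemma snorm_family_le w : L2_family w -> snorm ip_family w <= \sum_i snorm ip (w i).
Proof.
move=> Lw; have s0 : 0 <= \sum_i snorm ip (w i) by apply: sumr_ge0 => i _; exact: snorm_ge0.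
rewrite -(@ler_pXn2r _ 2) ?nnegrE ?snorm_ge0//.
rewrite (sqr_snorm L2_family_semi_inner)// /ip_family.
rewrite expr2 mulr_suml; apply: ler_sum => i _.
rewrite -(sqr_snorm (L2_semi_inner mO) (Lw i)) expr2 ler_wpM2l ?snorm_ge0//.
by rewrite (bigD1 i)//= lerDl sumr_ge0// => j _; exact: snorm_ge0.
Qed.

Lemma L2_family_complete : complete_for L2_family ip_family.
Proof.
move=> x Lx cx.
have /choice[y hy] i : exists y, L2 Omega y /\ forall e : R, 0 < e ->
    exists N, forall n, (N <= n)%N -> snorm ip (x n i - y) <= e.
  have [n|e e0|y Ly hy] := @L2_complete _ _ _ mO (fun n => x n i); first exact: Lx.
    have [N hN] := cx e e0; exists N => m n Nm Nn.
    apply: le_trans (hN m n Nm Nn).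
    apply: (@snorm_component (x m - x n) i).
    exact: (subspaceB L2_family_subspace).
  by exists y.
have Ly : L2_family y by move=> i; case: (hy i).
exists y => // e e0.
(* The family norm is at most the sum of the component norms, so every component gets an equal share
   of [e]. *)
have c0 : 0 < e / (#|I|%:R + 1) by rewrite divr_gt0// ltr_wpDl.
have /choice[N hN] i := (hy i).2 _ c0.
exists (\max_i N i) => n Nn.
apply: (le_trans (snorm_family_le _)); first exact: (subspaceB L2_family_subspace).
apply: (@le_trans _ _ (\sum_(i : I) e / (#|I|%:R + 1))).
  by apply: ler_sum => i _; apply: hN; apply: leq_trans Nn; exact: leq_bigmax.
rewrite sumr_const -[leLHS]mulr_natr mulrAC ler_pdivrMr ?ltr_wpDl//.
by rewrite ler_wpM2l ?(ltW e0)// lerDl.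
Qed.

End L2_family.

Lemma le_weighted_small (R : realFieldType) (a b e m n : R) : 0 <= a -> 0 <= b -> 0 < e ->
  m <= e / (a + b + 1) -> n <= e / (a + b + 1) -> a * m + b * n <= e.
Proof.
move=> a0 b0 e0 hm hn; have c0 : 0 < a + b + 1 by lra.
have q0 : 0 < e / (a + b + 1) by exact: divr_gt0.
have qE : e / (a + b + 1) * (a + b + 1) = e by rewrite divfK// gt_eqF.
have := ler_wpM2l a0 hm; have := ler_wpM2l b0 hn.
move: (e / _) q0 qE => q q0 qE; lra.
Qed.

(** * Sobolev spaces as spaces of jets *)

Section jets.
Context (R : realType) (d : nat) (Omega : set 'rV[R]_d) (mO : measurable Omega).
Context (L : R) (OL : forall x, Omega x -> `|x| <= L).
Local Notation E := 'rV[R]_d.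
Local Notation ip := (ip Omega).
Local Notation nrm := (snorm ip).
Local Notation L2ip := (L2_semi_inner mO).
Local Notation L2sub := (L2_subspace mO).
Implicit Types v w : option 'I_d -> E -> R^o.

Lemma ip_distr (f g h : E -> R^o) : L2 Omega f -> L2 Omega g -> L2 Omega h ->
  `|ip f g - ip f h| <= nrm f * nrm (g - h).
Proof.
move=> Lf Lg Lh; rewrite -(bilinear_onBr (semi_inner_bilinear L2ip))//.
exact: (cauchy_schwarz L2ip Lf (subspaceB L2sub Lg Lh)).
Qed.

Lemma ip_distl (f g h : E -> R^o) : L2 Omega f -> L2 Omega g -> L2 Omega h ->
  `|ip g f - ip h f| <= nrm f * nrm (g - h).
Proof. by move=> Lf Lg Lh; rewrite !(ipC _ _ f); exact: ip_distr. Qed.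

(* An element of H^1 with its weak gradient: [w None] is the function and
   [w (Some i)] its i-th weak derivative. *)
Definition weak_jet w : Prop := (forall j, L2 Omega (w j)) /\
  forall i, weak_partial Omega i (w None) (w (Some i)).

Definition jet (f : E -> R) : option 'I_d -> E -> R^o :=
  fun j => if j is Some i then partial i f else f.

Definition H10_jet w : Prop := forall e : R, 0 < e ->
  exists2 phi, test_function Omega phi & forall j, nrm (w j - jet phi j) < e.

Let test_L2 phi : test_function Omega phi -> L2 Omega phi.
Proof. exact: (test_function_L2 mO OL). Qed.

Lemma jet_L2 phi j : test_function Omega phi -> L2 Omega (jet phi j).
Proof.
by move=> tphi; case: j => [i|]; apply: test_L2 => //; exact: test_function_partial.
Qed.

Lemma weak_jetP w i phi : weak_jet w -> test_function Omega phi ->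
  ip (w None) (partial i phi) = - ip (w (Some i)) phi.
Proof. by move=> [_ +] tphi => /(_ i phi tphi). Qed.

Lemma weak_jet_lin a v w : weak_jet v -> weak_jet w -> weak_jet (a *: v + w).
Proof.
move=> wv ww; split => [j|i phi tphi]; first by apply: L2_lin => //; [case: wv|case: ww].
have Lp := test_L2 tphi; have Ldp := test_L2 (test_function_partial i tphi).
transitivity (ip (fun x => a * v None x + w None x) (partial i phi)); first by [].
transitivity (- ip (fun x => a * v (Some i) x + w (Some i) x) phi); last by [].
have [Lv _] := wv; have [Lw _] := ww.
rewrite !ipl// (weak_jetP _ wv tphi) (weak_jetP _ ww tphi); ring.
Qed.

Lemma weak_jet0 : weak_jet 0.
Proof.
split => [j|i phi tphi]; first exact: L2_0.
by under eq_Rintegral do rewrite mul0r; under [in RHS]eq_Rintegral do rewrite mul0r;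
   rewrite Rintegral_cst// mul0r oppr0.
Qed.

Lemma jet_lin a (f g : E -> R) : smooth f -> smooth g ->
  jet (fun x => a * f x + g x) = a *: jet f + jet g.
Proof.
move=> sf sg; apply/funext => -[i|] //; apply/funext => x.
by rewrite /jet partial_lin//; exact: smooth_derivable.
Qed.

Lemma H10_jet_lin a v w : weak_jet v -> weak_jet w -> H10_jet v -> H10_jet w ->
  H10_jet (a *: v + w).
Proof.
move=> [Lv _] [Lw _] hv hw e e0.
have a1 : 0 < `|a| + 1 by rewrite ltr_wpDl.
have e10 : 0 < e / 2 / (`|a| + 1) by rewrite !divr_gt0.
have e20 : 0 < e / 2 by rewrite divr_gt0.
have [f tf hf] := hv _ e10; have [g tg hg] := hw _ e20.
exists (fun x => a * f x + g x); first exact: test_function_lin.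
move=> j; rewrite jet_lin; [|by case: tf|by case: tg].
have -> : (a *: v + w) j - (a *: jet f + jet g) j =
    a *: (v j - jet f j) + (w j - jet g j).
  by rewrite scalerBr opprD addrACA.
have LA : L2 Omega (v j - jet f j) by apply: (subspaceB L2sub) => //; exact: jet_L2.
have LB : L2 Omega (w j - jet g j) by apply: (subspaceB L2sub) => //; exact: jet_L2.
apply: (le_lt_trans (snormD L2ip _ LB)); first exact: (subspaceZ L2sub).
rewrite (snormZ L2ip)// [e]splitr; apply: ler_ltD; last exact: hg.
apply: (@le_trans _ _ (`|a| * (e / 2 / (`|a| + 1)))).
  by rewrite ler_wpM2l// ltW.
rewrite mulrA ler_pdivrMr// mulrC ler_wpM2l ?(ltW e20)// lerDl.
by [].
Qed.

Lemma H10_jet0 : H10_jet 0.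
Proof.
move=> e e0; have s0 : smooth (fun _ : E => 0 : R).
  have p0 s : foldr partial (fun _ : E => 0 : R) s = (fun=> 0) :> (E -> R).
    elim: s => //= i s ->; apply/funext => x; exact: (derive_cst (0 : R)).
  move=> s; rewrite p0; split => [|i x]; first exact: cst_continuous.
  exact: derivable_cst.
have supp0 : [set x : E | (0 : R) != 0] = set0.
  by apply/seteqP; split => x //=; rewrite eqxx.
have t0 : test_function Omega (fun=> 0).
  by split; rewrite ?supp0 ?closure0//; exact: compact0.
exists (fun=> 0) => // j.
have -> : jet (fun=> 0) = 0.
  by apply/funext => -[i|]//; apply/funext => x; exact: (derive_cst (0 : R)).
by rewrite subr0 /snorm (bilinear_on0l L2sub (semi_inner_bilinear L2ip)) ?sqrtr0//; exact: L2_0.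
Qed.

Section limits.
Variables (x : nat -> option 'I_d -> E -> R^o) (y : option 'I_d -> E -> R^o).
Hypothesis wx : forall n, weak_jet (x n).
Hypothesis Ly : forall j, L2 Omega (y j).
Hypothesis xy : forall e : R, 0 < e -> exists n, forall j, nrm (x n j - y j) <= e.

(** Pairing with a fixed test function or its derivative is continuous in L2, so the identity
    defining weak derivatives is preserved. *)
Lemma weak_jet_limit : weak_jet y.
Proof.
split => // i phi tphi.
have Lp := test_L2 tphi; have Ldp := test_L2 (test_function_partial i tphi).
apply/eqP; rewrite -subr_eq0 opprK; apply/eqP/eq0_small => e e0.
rewrite -/(ip (y None) (partial i phi)) -/(ip (y (Some i)) phi).
have K0 : 0 < nrm (partial i phi) + nrm phi + 1 by rewrite ltr_wpDl// addr_ge0 ?snorm_ge0.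
have [n hn] := xy (divr_gt0 e0 K0).
have [Lx _] := wx n.
have := weak_jetP i (wx n) tphi => E0.
have h1 := ip_distl Ldp (Lx None) (Ly None).
have h2 := ip_distl Lp (Lx (Some i)) (Ly (Some i)).
have E1 : ip (y None) (partial i phi) + ip (y (Some i)) phi =
   - ((ip (x n None) (partial i phi) - ip (y None) (partial i phi)) +
      (ip (x n (Some i)) phi - ip (y (Some i)) phi)) by rewrite E0; ring.
rewrite E1 normrN; apply: (le_trans (ler_normD _ _)); apply: (le_trans (lerD h1 h2)).
exact: (le_weighted_small (snorm_ge0 _ _) (snorm_ge0 _ _) e0 (hn None) (hn (Some i))).
Qed.

Lemma H10_jet_limit : (forall n, H10_jet (x n)) -> H10_jet y.
Proof.
move=> hx e e0; have e20 : 0 < e / 2 by rewrite divr_gt0.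
have [n hn] := xy e20; have [phi tphi hphi] := hx n _ e20.
have [Lx _] := wx n.
exists phi => // j.
have -> : y j - jet phi j = (y j - x n j) + (x n j - jet phi j) by rewrite addrA subrK.
apply: (le_lt_trans (snormD L2ip _ _)).
- exact: (subspaceB L2sub).
- by apply: (subspaceB L2sub) => //; exact: jet_L2.
rewrite [e]splitr; apply: ler_ltD => //.
by rewrite (snormBC L2ip)//; exact: hn.
Qed.

End limits.

(* When [w] is a test function, both sides are [v None] paired with minus its mixed
   second derivative. *)
Lemma ip_mixed v w i j : weak_jet v -> weak_jet w -> H10_jet w ->
  ip (v (Some i)) (w (Some j)) = ip (v (Some j)) (w (Some i)).
Proof.
move=> wv [Lw _] hw; have [Lv _] := wv.
apply/eqP; rewrite -subr_eq0; apply/eqP/eq0_small => e e0.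
have K0 : 0 < nrm (v (Some i)) + nrm (v (Some j)) + 1.
  by rewrite ltr_wpDl// addr_ge0 ?snorm_ge0.
have [phi tphi hphi] := hw _ (divr_gt0 e0 K0).
have E0 : ip (v (Some i)) (partial j phi) = ip (v (Some j)) (partial i phi).
  have h1 := weak_jetP i wv (test_function_partial j tphi).
  have h2 := weak_jetP j wv (test_function_partial i tphi).
  have [sphi _ _] := tphi.
  by move: h2; rewrite (partial_comm j i sphi) h1 => /oppr_inj.
have Lp k : L2 Omega (partial k phi) := test_L2 (test_function_partial k tphi).
have h1 := ip_distr (Lv (Some i)) (Lw (Some j)) (Lp j).
have h2 := ip_distr (Lv (Some j)) (Lw (Some i)) (Lp i).
have E1 : ip (v (Some i)) (w (Some j)) - ip (v (Some j)) (w (Some i)) =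
  (ip (v (Some i)) (w (Some j)) - ip (v (Some i)) (partial j phi)) -
  (ip (v (Some j)) (w (Some i)) - ip (v (Some j)) (partial i phi)) by rewrite E0; ring.
rewrite E1; apply: (le_trans (ler_normB _ _)); apply: (le_trans (lerD h1 h2)).
exact: (le_weighted_small (snorm_ge0 _ _) (snorm_ge0 _ _) e0
  (ltW (hphi (Some j))) (ltW (hphi (Some i)))).
Qed.

End jets.

(** * Control of a displacement by its curl and divergence *)

Section coercivity.
Context (R : realType) (d : nat).
Local Notation E := 'rV[R]_d.

(** Density of test functions carries [friedrichs] over to the closure; the constant is the square
    root of [4 * L ^+ 2]. *)
Lemma H10_friedrichs (hd : (0 < d)%N) (Omega : set E) (L : R)
    (w : option 'I_d -> E -> R^o) : measurable Omega ->
  (forall x, Omega x -> `|x| <= L) -> 0 <= L ->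
  (forall j, L2 Omega (w j)) -> H10_jet Omega w ->
  snorm (ip Omega) (w None) <= 2 * L * snorm (ip Omega) (w (Some (Ordinal hd))).
Proof.
case: d hd Omega w => // n hn Omega w mO OL L0 Lw hw.
have -> : Ordinal hn = ord0 by exact: val_inj.
pose ipO := L2_semi_inner mO.
apply/ler_addgt0Pl => e e0.
(* The approximation error enters once through the function and [2 * L] times through its
   derivative. *)
have L1 : 0 < 2 * L + 1 by lra.
have [phi tphi hphi] := hw _ (divr_gt0 e0 L1).
have Lp := test_function_L2 mO OL tphi.
have Ldp := test_function_L2 mO OL (test_function_partial ord0 tphi).
have F : snorm (ip Omega) phi <= 2 * L * snorm (ip Omega) (partial ord0 phi).
  rewrite -(@ler_pXn2r _ 2) ?nnegrE ?mulr_ge0 ?snorm_ge0// exprMn.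
  rewrite (sqr_snorm ipO Lp) (sqr_snorm ipO Ldp) exprMn (_ : 2 ^+ 2 = 4); last by ring.
  exact: friedrichs.
have h1 := snormD ipO (subspaceB (L2_subspace mO) (Lw None) Lp) Lp.
have h2 := snormD ipO (subspaceB (L2_subspace mO) Ldp (Lw (Some ord0))) (Lw (Some ord0)).
rewrite !subrK in h1 h2.
have h3 := hphi None; have := hphi (Some ord0); rewrite /= in h3 *.
rewrite (snormBC ipO (Lw _) Ldp).
move: (snorm _ _) (snorm _ _) (snorm _ _) (snorm _ _) (snorm _ _) (snorm _ _) h1 h2 h3 F.
move: (e / _) (divfK (lt0r_neq0 L1) e) => q qE a b c m k r h1 h2 h3 F h4.
have := ler_wpM2l L0 h2; have := ler_wpM2l L0 (ltW h4); lra.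
Qed.

(** Pointwise, curl and divergence miss the full gradient only by its two-by-two principal
    minors. *)
Lemma curl_div_mx (hd : d = 2%N \/ d = 3%N) (G : 'I_d -> 'I_d -> R) :
  \sum_k curl_mx G k ^+ 2 + (\sum_i G i i) ^+ 2 =
  \sum_i \sum_j (G i j ^+ 2 + (G i i * G j j - G i j * G j i)).
Proof.
case: hd G => -> G.
  rewrite !big_ord_recl !big_ord0 /=.
  rewrite (_ : lift ord0 ord0 = 1 :> 'I_2); last exact: val_inj.
  rewrite (_ : ord0 = 0 :> 'I_2)//.
  ring.
rewrite !big_ord_recl !big_ord0 /=.
rewrite (_ : lift ord0 (lift ord0 ord0) = 2 :> 'I_3); last exact: val_inj.
rewrite (_ : lift ord0 ord0 = 1 :> 'I_3); last exact: val_inj.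
rewrite (_ : ord0 = 0 :> 'I_3)//.
rewrite !add0r.
rewrite (_ : 1 + 2 = 0 :> 'I_3); last exact: val_inj.
rewrite (_ : 1 + 1 = 2 :> 'I_3); last exact: val_inj.
rewrite (_ : 2 + 2 = 1 :> 'I_3); last exact: val_inj.
rewrite (_ : 2 + 1 = 0 :> 'I_3); last exact: val_inj.
ring.
Qed.

Lemma curl_mx0 (hd : d = 2%N \/ d = 3%N) k :
  curl_mx (fun _ _ : 'I_d => 0 : R) k = 0.
Proof. by case: hd k => -> k; exact: subrr. Qed.

Lemma curl_mx_L2 (hd : d = 2%N \/ d = 3%N) (Omega : set E) (G : 'I_d -> 'I_d -> E -> R) k :
  measurable Omega -> (forall i j, L2 Omega (G i j)) ->
  L2 Omega (fun x => curl_mx (fun i j => G i j x) k).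
Proof.
by move=> mO; case: hd k Omega mO G => -> k Omega mO G LG; exact: (subspaceB (L2_subspace mO)).
Qed.

(** Each minor integrates to zero by [ip_mixed], which exchanges the two differentiation indices. *)
Lemma curl_div_identity (hd : d = 2%N \/ d = 3%N) (Omega : set E) (L : R)
    (V : 'I_d -> option 'I_d -> E -> R^o) :
  measurable Omega -> (forall x, Omega x -> `|x| <= L) ->
  (forall i, weak_jet Omega (V i)) -> (forall i, H10_jet Omega (V i)) ->
  let c k x := curl_mx (fun i j => V i (Some j) x) k in
  let dv x := \sum_i V i (Some i) x in
  \sum_k ip Omega (c k) (c k) + ip Omega dv dv =
  \sum_i \sum_j ip Omega (V i (Some j)) (V i (Some j)).
Proof.
move=> mO OL wV hV c dv.
have LV i j : L2 Omega (V i (Some j)) by case: (wV i).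
have Lc k : L2 Omega (c k) by apply: curl_mx_L2.
have int i j i' j' := L2_mul_integrable mO (LV i j) (LV i' j').
have i1 i j : (lebesgue_rV d).-integrable Omega
    (EFin \o (fun x => V i (Some i) x * V j (Some j) x - V i (Some j) x * V j (Some i) x)).
  by apply: eq_integrable (integrableB mO (int i i j j) (int i j j i)).
have i2 i j : (lebesgue_rV d).-integrable Omega (EFin \o (fun x => V i (Some j) x * V i (Some j) x
    + (V i (Some i) x * V j (Some j) x - V i (Some j) x * V j (Some i) x))).
  by apply: eq_integrable (integrableD mO (int i j i j) (i1 i j)).
have [i3 I3] := Rintegral_sum mO (index_enum _) (fun k => L2_mul_integrable mO (Lc k) (Lc k)).
have Ldv : L2 Omega dv.
  suff : forall s, L2 Omega (fun x => \sum_(i <- s) V i (Some i) x) by apply.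
  elim=> [|i s IH]; first by under eq_fun do rewrite big_nil; exact: L2_0.
  under eq_fun do rewrite big_cons; exact: (subspaceD (L2_subspace mO)).
have Idv := L2_mul_integrable mO Ldv Ldv.
transitivity (\int[lebesgue_rV d]_(x in Omega)
    (\sum_i \sum_j (V i (Some j) x * V i (Some j) x
      + (V i (Some i) x * V j (Some j) x - V i (Some j) x * V j (Some i) x)))).
  rewrite /ip -I3 -RintegralD//; apply: eq_Rintegral => x _.
  have := curl_div_mx hd (fun i j => V i (Some j) x).
  rewrite expr2 -/(dv x) => H.
  transitivity (\sum_k c k x ^+ 2 + dv x * dv x).
    by congr (_ + _); apply: eq_bigr => k _; rewrite expr2.
  by rewrite H; apply: eq_bigr => i _; apply: eq_bigr => j _; rewrite expr2.
have [_ ->] := Rintegral_sum mO (index_enum _)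
  (fun i => (Rintegral_sum mO (index_enum _) (i2 i)).1).
apply: eq_bigr => i _; have [_ ->] := Rintegral_sum mO (index_enum _) (i2 i).
apply: eq_bigr => j _; rewrite RintegralD// RintegralB//.
have := ip_mixed mO OL i j (wV i) (wV j) (hV j); rewrite /ip => ->.
by rewrite subrr addr0.
Qed.

End coercivity.

(** * Bounded maps and forms *)

Section bounded_maps.
Context (R : realType) (d : nat) (Omega : set 'rV[R]_d) (mO : measurable Omega) (I : finType).
Local Notation E := 'rV[R]_d.
Local Notation ip := (ip Omega).
Local Notation nrm := (snorm ip).
Local Notation W := (I -> E -> R^o).
Local Notation LW := (@L2_family R d Omega I).
Local Notation nW := (snorm (@ip_family R d Omega I)).
Local Notation L2ip := (L2_semi_inner mO).
Local Notation L2sub := (L2_subspace mO).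

(** Curl, divergence, weighted gradients and the total pressure all have this shape. Their
    boundedness serves continuity of the form, the bound on the energy norm, and uniqueness. *)
Record bounded_map (A : W -> E -> R^o) : Prop := {
  bounded_map_lin : forall a w z, A (a *: w + z) = a *: A w + A z;
  bounded_map_L2 : forall w, LW w -> L2 Omega (A w);
  bounded_map_le : exists2 C, 0 <= C & forall w, LW w -> nrm (A w) <= C * nW w }.

Lemma bounded_map_component i : bounded_map (fun w => w i).
Proof.
split => //; exists 1 => // w Lw.
by rewrite mul1r; exact: snorm_component.
Qed.

Lemma bounded_map0 : bounded_map (fun=> 0).
Proof.
split => [a w z|w _|]; [by rewrite scaler0 addr0|exact: L2_0|].
exists 0 => // w _; rewrite mul0r /snorm (bilinear_on0l L2sub (semi_inner_bilinear L2ip)) ?sqrtr0//.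
exact: L2_0.
Qed.

Lemma bounded_mapL a A B : bounded_map A -> bounded_map B ->
  bounded_map (fun w => a *: A w + B w).
Proof.
move=> [lA LA [CA CA0 hA]] [lB LB [CB CB0 hB]]; split => [b w z|w Lw|].
- rewrite lA lB !scalerDr !scalerA addrACA.
  by rewrite (mulrC a b) -!scalerA.
- by apply: (subspaceL L2sub); [exact: LA|exact: LB].
exists (`|a| * CA + CB) => [|w Lw]; first by rewrite addr_ge0// mulr_ge0.
apply: (le_trans (snormD L2ip (subspaceZ L2sub a (LA _ Lw)) (LB _ Lw))).
rewrite (snormZ L2ip _ (LA _ Lw)) mulrDl -mulrA lerD ?hB// ler_wpM2l// hA//.
Qed.

Lemma bounded_map_sum (J : Type) (s : seq J) (A : J -> W -> E -> R^o) :
  (forall j, bounded_map (A j)) -> bounded_map (fun w => \sum_(j <- s) A j w).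
Proof.
move=> hA; elim: s => [|j s IH].
  rewrite (_ : (fun _ => _) = (fun=> 0)); first exact: bounded_map0.
  by apply/funext => w; rewrite big_nil.
rewrite (_ : (fun _ => _) = (fun w => 1 *: A j w + \sum_(j <- s) A j w)).
  exact: bounded_mapL.
by apply/funext => w; rewrite big_cons scale1r.
Qed.

Lemma weight_L2 (m : E -> R) (K : R) f : measurable_fun Omega m ->
  (forall x, Omega x -> `|m x| <= K) -> L2 Omega f -> L2 Omega (fun x => m x * f x).
Proof.
move=> mm mK Lf; apply: (@L2_le _ _ _ mO _ (fun x => K * f x)).
- by apply: measurable_funM => //; case: Lf.
- by move=> x Ox; rewrite !normrM ler_wpM2r// (le_trans (mK _ Ox))// ler_norm.
- exact: L2Z.
Qed.

Lemma nrm_le (f g : E -> R) : L2 Omega f -> L2 Omega g ->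
  (forall x, Omega x -> `|f x| <= `|g x|) -> nrm f <= nrm g.
Proof.
move=> Lf Lg fg; rewrite ler_wsqrtr//; apply: le_Rintegral => //.
- exact: L2_mul_integrable.
- exact: L2_mul_integrable.
by move=> x Ox; rewrite -!expr2 -real_normK ?num_real// -[leRHS]real_normK ?num_real//
  lerXn2r ?nnegrE// fg.
Qed.

Lemma weight_nrm_le (m : E -> R) (K : R) f : measurable_fun Omega m ->
  (forall x, Omega x -> `|m x| <= K) -> 0 <= K -> L2 Omega f ->
  nrm (fun x => m x * f x) <= K * nrm f.
Proof.
move=> mm mK K0 Lf; rewrite -[X in X * _]ger0_norm// -(snormZ L2ip _ Lf).
apply: nrm_le; [exact: weight_L2 mK Lf|exact: (subspaceZ L2sub)|].
by move=> x Ox; rewrite normrM [leRHS]normrM ler_wpM2r// (le_trans (mK _ Ox))// ler_norm.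
Qed.

(** Strips a weight bounded below off a norm; this is how bare norms of [g] and [s] are recovered
    from the weighted [data_norm]. *)
Lemma weight_nrm_ge (m : E -> R) (r K : R) f : measurable_fun Omega m ->
  (forall x, Omega x -> r <= m x <= K) -> 0 <= r -> L2 Omega f ->
  r * nrm f <= nrm (fun x => m x * f x).
Proof.
move=> mm mK r0 Lf.
have mK' x : Omega x -> `|m x| <= K.
  by move=> /mK /andP[rm mk]; rewrite ger0_norm// (le_trans r0).
rewrite -[X in X * _]ger0_norm// -(snormZ L2ip _ Lf).
apply: nrm_le; [exact: (subspaceZ L2sub)|exact: weight_L2 mK' Lf|].
move=> x /mK /andP[rm _]; rewrite normrM [leRHS]normrM ler_wpM2r//.
by rewrite ger0_norm// ger0_norm// (le_trans r0).
Qed.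

Lemma bounded_map_weight (m : E -> R) (K : R) A : measurable_fun Omega m ->
  (forall x, Omega x -> `|m x| <= K) -> 0 <= K -> bounded_map A ->
  bounded_map (fun w x => m x * A w x).
Proof.
move=> mm mK K0 [lA LA [C C0 hA]]; split => [a w z|w Lw|].
- rewrite lA; apply/funext => x.
  change (m x * (a * A w x + A z x) = a * (m x * A w x) + m x * A z x); ring.
- by apply: weight_L2 mK _ => //; exact: LA.
- exists (K * C) => [|w Lw]; first exact: mulr_ge0.
  apply: (le_trans (weight_nrm_le mm mK K0 (LA _ Lw))).
  by rewrite -mulrA ler_wpM2l// hA.
Qed.

Definition bounded_form (a : W -> W -> R) : Prop := bilinear_on LW a /\
  exists2 C, 0 <= C & forall w z, LW w -> LW z -> `|a w z| <= C * nW w * nW z.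

Lemma bounded_form_ip A B : bounded_map A -> bounded_map B ->
  bounded_form (fun w z => ip (A w) (B z)).
Proof.
move=> [lA LA [CA CA0 hA]] [lB LB [CB CB0 hB]]; split.
  split => a w z t Lw Lz Lt.
    by rewrite lA; apply: (bilinearl (semi_inner_bilinear L2ip)); auto.
  by rewrite lB; apply: (bilinearr (semi_inner_bilinear L2ip)); auto.
exists (CA * CB) => [|w z Lw Lz]; first exact: mulr_ge0.
apply: (le_trans (cauchy_schwarz L2ip (LA _ Lw) (LB _ Lz))).
apply: (@le_trans _ _ ((CA * nW w) * (CB * nW z))); last lra.
by apply: ler_pM; rewrite ?snorm_ge0 ?hA ?hB.
Qed.

Lemma bounded_formL k a a' : bounded_form a -> bounded_form a' ->
  bounded_form (fun w z => k * a w z + a' w z).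
Proof.
move=> [[al ar] [C C0 ha]] [[al' ar'] [C' C0' ha']]; split.
  split => b w z t Lw Lz Lt; rewrite ?al ?al' ?ar ?ar'//; ring.
exists (`|k| * C + C') => [|w z Lw Lz]; first by rewrite addr_ge0// mulr_ge0.
rewrite (le_trans (ler_normD _ _))// normrM !mulrDl lerD ?ha'//.
by rewrite -!mulrA ler_wpM2l// mulrA ha.
Qed.

Lemma bounded_form0 : bounded_form (fun _ _ => 0).
Proof.
split; first by split => *; rewrite mulr0 addr0.
by exists 0 => // w z _ _; rewrite normr0 !mul0r.
Qed.

Lemma bounded_form_sum (J : Type) (s : seq J) (a : J -> W -> W -> R) :
  (forall j, bounded_form (a j)) -> bounded_form (fun w z => \sum_(j <- s) a j w z).
Proof.
move=> ha; elim: s => [|j s IH].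
  rewrite (_ : (fun _ _ => _) = (fun _ _ => 0)); first exact: bounded_form0.
  by apply/funext => w; apply/funext => z; rewrite big_nil.
rewrite (_ : (fun _ _ => _) = (fun w z => 1 * a j w z + \sum_(j <- s) a j w z)).
  exact: bounded_formL.
by apply/funext => w; apply/funext => z; rewrite big_cons mul1r.
Qed.

End bounded_maps.

(** * The reduced displacement-pressure problem *)

Section biot_space.
Context (R : realType) (d : nat) (Omega : set 'rV[R]_d).
Local Notation E := 'rV[R]_d.
Local Notation W := (option 'I_d * option 'I_d -> E -> R^o).
Local Notation LW := (@L2_family R d Omega (option 'I_d * option 'I_d)%type).
Local Notation ipW := (@ip_family R d Omega (option 'I_d * option 'I_d)%type).
Local Notation ip := (ip Omega).
Local Notation nrm := (snorm ip).

(* The jets of a displacement [u] in H^1_0 and of a pressure [p] in H^1, as one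
   family: [w (Some i, _)] is the jet of [u i] and [w (None, _)] that of [p]. *)
Definition biot_space : set W :=
  [set w | (forall c, weak_jet Omega (fun j => w (c, j))) /\
           forall i, H10_jet Omega (fun j => w (Some i, j))].

Definition H1_jet (p : H1 Omega) : option 'I_d -> E -> R^o :=
  fun j => if j is Some i then grad p i else p.

Definition biot_jet (u : 'I_d -> H1 Omega) (p : H1 Omega) : W :=
  fun c => H1_jet (if c.1 is Some i then u i else p) c.2.

Lemma H1_jet_weak p : weak_jet Omega (H1_jet p).
Proof.
split => [[i|]|i]; [exact: grad_L2|exact: H1fun_L2|exact: gradP].
Qed.

Lemma in_H10P (v : H1 Omega) : in_H10 v <-> H10_jet Omega (H1_jet v).
Proof.
split => h e e0.
  have [phi [tphi h1 h2]] := h e e0; exists phi => // -[i|].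
    by have := h2 i; rewrite norm0E.
  by have := h1; rewrite norm0E.
have [phi tphi hphi] := h e e0; exists phi; split => //.
  by rewrite norm0E; exact: (hphi None).
by move=> i; rewrite norm0E; exact: (hphi (Some i)).
Qed.

Lemma biot_jet_space u p : H10v u -> biot_space (biot_jet u p).
Proof.
move=> hu; split => [[i|]|i]; [exact: H1_jet_weak|exact: H1_jet_weak|].
exact/in_H10P.
Qed.

(** The equality is exact, not almost everywhere, so a jet found by Lax-Milgram can be replaced by a
    record without further argument. *)
Lemma weak_jet_H1 w : weak_jet Omega w -> exists p : H1 Omega, H1_jet p = w.
Proof.
move=> [Lw ww]; exists (@Build_H1 _ _ _ (w None) (fun i => w (Some i)) (Lw None)
  (fun i => Lw (Some i)) ww).
by apply/funext => -[].
Qed.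

Lemma biot_space_jet w : biot_space w ->
  exists u p, H10v u /\ biot_jet u p = w.
Proof.
move=> [ww hw]; have /choice[q hq] c := weak_jet_H1 (ww c).
exists (fun i => q (Some i)), (q None); split => [i|].
  by apply/in_H10P; rewrite hq.
apply/funext => -[[i|] j]; rewrite /biot_jet /=; first by rewrite hq.
by rewrite hq.
Qed.

Lemma biot_space_L2 w : biot_space w -> LW w.
Proof. by move=> [ww _] [c j]; have [Lw _] := ww c; exact: (Lw j). Qed.

Context (mO : measurable Omega) (L : R) (OL : forall x, Omega x -> `|x| <= L).

Lemma biot_space_subspace : subspace biot_space.
Proof.
split.
  split => [c|i]; first exact: (weak_jet0 mO).
  exact: (H10_jet0 mO).
move=> a v w [wv hv] [ww hw]; split => [c|i].
  exact: (weak_jet_lin mO OL a (wv c) (ww c)).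
exact: (H10_jet_lin mO OL a (wv _) (ww _) (hv i) (hw i)).
Qed.

Lemma biot_space_semi_inner : semi_inner biot_space ipW.
Proof.
have [_ [bl br] bC b0] := L2_family_semi_inner mO (option 'I_d * option 'I_d)%type.
split; first exact: biot_space_subspace.
- by split => a x y z /biot_space_L2 Lx /biot_space_L2 Ly /biot_space_L2 Lz; auto.
- by move=> x y /biot_space_L2 Lx /biot_space_L2 Ly; exact: bC.
- by move=> x /biot_space_L2; exact: b0.
Qed.

(** A closed subset of the complete space of L2 families. *)
Lemma biot_space_complete : complete_for biot_space ipW.
Proof.
move=> x Sx cx.
have [n|y Ly hy] := L2_family_complete mO _ cx; first exact: biot_space_L2.
exists y => //.
have lim c e : 0 < e -> exists n, forall j, nrm (x n (c, j) - y (c, j)) <= e.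
  move=> e0; have [N hN] := hy e e0; exists N => j.
  apply: le_trans (hN N (leqnn _)).
  apply: (@snorm_component _ _ _ mO _ (x N - y) (c, j)).
  by apply: (subspaceB (L2_family_subspace mO _)) => //; exact: biot_space_L2.
split => [c|i].
  apply: (weak_jet_limit mO OL (x := fun n j => x n (c, j))) => [n|j|].
  - by case: (Sx n).
  - exact: Ly.
  - exact: lim.
apply: (H10_jet_limit mO OL (x := fun n j => x n (Some i, j))) => [n|j||n].
- by case: (Sx n).
- exact: Ly.
- exact: lim.
- by case: (Sx n).
Qed.

Definition jet_curl (w : W) : 'I_(rot_dim d) -> E -> R^o :=
  fun k x => curl_mx (fun i j => w (Some i, Some j) x) k.

Definition jet_div (w : W) : E -> R^o := fun x => \sum_i w (Some i, Some i) x.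

Lemma bounded_map_div : bounded_map Omega jet_div.
Proof.
rewrite (_ : jet_div = (fun w : W => \sum_i w (Some i, Some i))).
  by apply: bounded_map_sum => // i; exact: bounded_map_component.
by apply/funext => w; apply/funext => x; rewrite fct_sumE.
Qed.

End biot_space.

Lemma bounded_map_curl (R : realType) (d : nat) (hd : d = 2%N \/ d = 3%N)
    (Omega : set 'rV[R]_d) (mO : measurable Omega) k :
  bounded_map Omega (fun w => jet_curl w k).
Proof.
have cmp i j : bounded_map Omega (fun w : option 'I_d * option 'I_d -> 'rV[R]_d -> R^o => w (i, j)).
  exact: bounded_map_component.
case: hd k Omega mO cmp => -> k Omega mO cmp.
  rewrite (_ : (fun w => _) = (fun w => (-1) *: w (Some 0, Some 1) + w (Some 1, Some 0))).
    exact: bounded_mapL.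
  by apply/funext => w; rewrite scaleN1r addrC.
rewrite (_ : (fun w => _) = (fun w => (-1) *: w (Some (k + 1), Some (k + 2)) +
    w (Some (k + 2), Some (k + 1)))).
  exact: bounded_mapL.
by apply/funext => w; rewrite scaleN1r addrC.
Qed.

Section reduced_problem.
Context (R : realType) (d : nat) (hd : d = 2%N \/ d = 3%N).
Context (Omega : set 'rV[R]_d) (mO : measurable Omega).
Context (L : R) (L0 : 0 <= L) (OL : forall x, Omega x -> `|x| <= L).
Context (muP lambdaP alpha c0 xi rho kappa1 kappa2 : R) (kappa : 'rV[R]_d -> R).
Hypotheses (hmuP : 0 < muP) (hlambdaP : 0 <= lambdaP).
Hypotheses (hc0 : 0 < c0) (hxi : 0 < xi) (hrho : 0 < rho) (hkappa1 : 0 < kappa1).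
Hypothesis mkappa : measurable_fun Omega kappa.
Hypothesis hkappa : forall x, Omega x -> kappa1 <= kappa x <= kappa2.
Hypothesis hkappa2 : 0 < kappa2.
Local Notation E := 'rV[R]_d.
Local Notation W := (option 'I_d * option 'I_d -> E -> R^o).
Local Notation LW := (@L2_family R d Omega (option 'I_d * option 'I_d)%type).
Local Notation ipW := (@ip_family R d Omega (option 'I_d * option 'I_d)%type).
Local Notation ip := (ip Omega).
Local Notation nrm := (snorm ip).
Local Notation S := (biot_space Omega).
Local Notation M := (lameM muP lambdaP).
Local Notation curl := (@jet_curl R d).
Local Notation dv := (@jet_div R d).
Local Notation L2ip := (L2_semi_inner mO).
Local Notation L2sub := (L2_subspace mO).

(** Nested to the right so that each summand is peeled off by [bounded_formL]. The pressure is
    weighted by [c0] alone: the term alpha^2 / M disappears on eliminating the total pressure. *)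
Definition reduced_form (w z : W) : R :=
  muP * (\sum_k ip (curl w k) (curl z k)) + (M * ip (dv w) (dv z)
  + (- alpha * ip (w (None, None)) (dv z) + (alpha * ip (dv w) (z (None, None))
  + (c0 * ip (w (None, None)) (z (None, None))
  + xi^-1 * (\sum_j ip (fun x => kappa x * w (None, Some j) x) (z (None, Some j))))))).

Definition reduced_load (f g : 'I_d -> E -> R) (s : E -> R) (z : W) : R :=
  \sum_i ip (f i) (z (Some i, None))
  + rho / xi * (\sum_j ip (fun x => kappa x * g j x) (z (None, Some j)))
  + ip s (z (None, None)).

Let cmp i j : bounded_map Omega (fun w : W => w (i, j)) := bounded_map_component mO (i, j).

Let kappa_le x : Omega x -> `|kappa x| <= kappa2.
Proof. by move=> /hkappa /andP[k1 k2]; rewrite ger0_norm// (le_trans (ltW hkappa1)). Qed.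

Lemma reduced_form_bounded : bounded_form Omega reduced_form.
Proof.
have ipb (A B : W -> E -> R^o) : bounded_map Omega A -> bounded_map Omega B ->
    bounded_form Omega (fun w z => ip (A w) (B z)) by exact: bounded_form_ip.
rewrite /reduced_form; apply: (bounded_formL muP).
  apply: bounded_form_sum => // k.
  by apply: (ipb (fun w => curl w k) (fun w => curl w k)); exact: bounded_map_curl.
have bdv := bounded_map_div mO.
apply: (bounded_formL M); first exact: ipb.
apply: (bounded_formL (- alpha)); first exact: (ipb (fun w => w (None, None))).
apply: (bounded_formL alpha); first exact: (ipb _ (fun w => w (None, None))).
apply: (bounded_formL c0).
  exact: (ipb (fun w => w (None, None)) (fun w => w (None, None))).
rewrite (_ : (fun _ _ => _) = (fun w z : W =>
    xi^-1 * (\sum_j ip (fun x => kappa x * w (None, Some j) x) (z (None, Some j))) + 0)).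
  apply: (bounded_formL xi^-1); last exact: bounded_form0.
  apply: bounded_form_sum => // j.
  apply: (ipb (fun w x => kappa x * w (None, Some j) x) (fun w => w (None, Some j))) => //.
  by apply: (bounded_map_weight mO mkappa kappa_le (ltW hkappa2)).
by apply/funext => w; apply/funext => z; rewrite addr0.
Qed.

Lemma lameM_ge : muP <= M.
Proof. by rewrite /lameM mulr_natl mulr2n -addrA lerDl addr_ge0 ?(ltW hmuP). Qed.

Lemma lameM_gt0 : 0 < M.
Proof. exact: lt_le_trans hmuP lameM_ge. Qed.

Lemma reduced_form_coercive : exists2 c, 0 < c &
  forall w, S w -> c * ipW w w <= reduced_form w w.
Proof.
(* Friedrichs bounds each of the [d] squared components by [4 * L ^+ 2] times the squared gradient
   of the whole displacement, so function and gradient together cost this denominator. *)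
pose c1 := muP / (1 + d%:R * (4 * L ^+ 2)).
have D0 : 0 < 1 + d%:R * (4 * L ^+ 2) by rewrite ltr_pwDl// mulr_ge0// mulr_ge0// exprn_ge0.
have c10 : 0 < c1 by rewrite divr_gt0.
exists (Num.min c1 (Num.min c0 (kappa1 / xi))).
  by rewrite !lt_min c10 hc0 divr_gt0.
move=> w Sw; have [ww hw] := Sw.
have Lw : forall c j, L2 Omega (w (c, j)).
  by move=> c j; exact: (biot_space_L2 Sw (c, j)).
have ip0 f : L2 Omega f -> 0 <= ip f f by exact: (semi_inner_ge0 L2ip).
set c := Num.min _ _.
have cc1 : c <= c1 by rewrite ge_min lexx.
have cc0 : c <= c0 by rewrite !ge_min lexx orbT.
have ck : c <= kappa1 / xi by rewrite !ge_min lexx !orbT.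
pose P := ip (w (None, None)) (w (None, None)).
pose GP := \sum_j ip (w (None, Some j)) (w (None, Some j)).
pose U := \sum_i ip (w (Some i, None)) (w (Some i, None)).
pose GU := \sum_i \sum_j ip (w (Some i, Some j)) (w (Some i, Some j)).
have sum_option (F : option 'I_d -> R) : \sum_c F c = F None + \sum_i F (Some i).
  rewrite (bigD1 None)//=; congr (_ + _).
  rewrite (reindex_omap Some id)/=; last by case.
  by apply: eq_bigl => i; rewrite eqxx.
have -> : ipW w w = P + GP + (U + GU).
  transitivity (\sum_c \sum_j ip (w (c, j)) (w (c, j))).
    by rewrite pair_bigA; apply: eq_bigr => -[].
  rewrite sum_option sum_option; congr (_ + _).
  by rewrite -big_split; apply: eq_bigr => i _; rewrite sum_option.
have GP0 : 0 <= GP by apply: sumr_ge0 => j _; exact: ip0.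
have GU0 : 0 <= GU by apply: sumr_ge0 => i _; apply: sumr_ge0 => j _; exact: ip0.
have P0 : 0 <= P by exact: ip0.
have d0 : (0 < d)%N by case: hd => ->.
have hU : U <= d%:R * (4 * L ^+ 2) * GU.
  have h i : ip (w (Some i, None)) (w (Some i, None)) <= 4 * L ^+ 2 * GU.
    have := H10_friedrichs d0 mO OL L0 (fun j => Lw (Some i) j) (hw i).
    rewrite -(@ler_pXn2r _ 2) ?nnegrE ?mulr_ge0 ?snorm_ge0// exprMn.
    rewrite !(sqr_snorm L2ip)// exprMn (_ : 2 ^+ 2 = 4); last by ring.
    move=> h; apply: (le_trans h); apply: ler_wpM2l.
      by rewrite mulr_ge0// exprn_ge0.
    rewrite /GU (bigD1 i)//= (bigD1 (Ordinal d0))//= -addrA lerDl addr_ge0//.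
      by apply: sumr_ge0 => j _; exact: ip0.
    by apply: sumr_ge0 => i' _; apply: sumr_ge0 => j _; exact: ip0.
  apply: (@le_trans _ _ (\sum_(i < d) 4 * L ^+ 2 * GU)); first exact: ler_sum.
  by rewrite sumr_const card_ord -[leLHS]mulr_natl mulrA.
have CD := curl_div_identity hd mO OL (fun i => ww (Some i)) hw.
rewrite -/GU /= -/(dv w) in CD.
have hK : kappa1 * GP <= \sum_j ip (fun x => kappa x * w (None, Some j) x) (w (None, Some j)).
  rewrite /GP mulr_sumr; apply: ler_sum => j _.
  have Lkw := weight_L2 mO mkappa kappa_le (Lw None (Some j)).
  rewrite -RintegralZl//; last exact: L2_mul_integrable.
  apply: le_Rintegral => //.
  - have := L2_mul_integrable mO (L2Z mO kappa1 (Lw None (Some j))) (Lw None (Some j)).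
    by apply: eq_integrable => // x _; rewrite /= mulrA.
  - exact: L2_mul_integrable.
  by move=> x /hkappa /andP[k1 _]; rewrite mulrA -!mulrA ler_wpM2r// -expr2 sqr_ge0.
rewrite /reduced_form -/P.
set CC := \sum_k _ in CD *; set DD := ip (dv w) (dv w) in CD *.
rewrite (ipC _ (dv w) (w (None, None))); set X := ip _ (dv w).
set KK := \sum_j _ in hK *.
have DD0 : 0 <= DD by apply: ip0; have [_ + _] := bounded_map_div mO; apply; exact: biot_space_L2.
have h1 := ler_wpM2r DD0 lameM_ge.
have h2 : c * (U + GU) <= muP * GU.
  apply: (@le_trans _ _ (c1 * (U + GU))).
    rewrite ler_wpM2r// addr_ge0//; apply: sumr_ge0 => i _; exact: ip0.
  rewrite /c1 mulrAC ler_pdivrMr// -mulrA ler_wpM2l ?(ltW hmuP)// mulrC mulrDl; lra.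
have h3 := ler_wpM2r P0 cc0.
have h4 : c * GP <= xi^-1 * KK.
  apply: (@le_trans _ _ (kappa1 / xi * GP)); first exact: ler_wpM2r.
  by rewrite mulrAC mulrC ler_wpM2l// invr_ge0 ltW.
have CD' : muP * CC + muP * DD = muP * GU by rewrite -mulrDr CD.
lra.
Qed.


(** * Integrals of the statement as semi-inner products, and bounds on the data *)

Lemma norm0v_snorm m (v : 'I_m -> E -> R) : L2v Omega v ->
  norm0v Omega v = @snorm R ('I_m -> E -> R^o) (@ip_family R d Omega 'I_m) v.
Proof.
move=> Lv; rewrite /norm0v /snorm /dot /ip_family.
by have [_ ->] := Rintegral_sum mO (index_enum _) (fun k => L2_mul_integrable mO (Lv k) (Lv k)).
Qed.

Lemma dot_integral m (v w : 'I_m -> E -> R) : L2v Omega v -> L2v Omega w ->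
  \int[lebesgue_rV d]_(x in Omega) dot v w x = \sum_k ip (v k) (w k).
Proof.
move=> Lv Lw; rewrite /dot.
by have [_ ->] := Rintegral_sum mO (index_enum _) (fun k => L2_mul_integrable mO (Lv k) (Lw k)).
Qed.

Lemma weighted_dot_integral m (v w : 'I_m -> E -> R) : L2v Omega v -> L2v Omega w ->
  \int[lebesgue_rV d]_(x in Omega) (kappa x * dot v w x) =
  \sum_k ip (fun x => kappa x * v k x) (w k).
Proof.
move=> Lv Lw; rewrite -dot_integral// => [|k]; last exact: weight_L2 kappa_le (Lv k).
by apply: eq_Rintegral => x _; rewrite /dot mulr_sumr; apply: eq_bigr => k _; rewrite mulrA.
Qed.

Lemma component_le_norm0v m (v : 'I_m -> E -> R) k : L2v Omega v ->
  nrm (v k) <= norm0v Omega v.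
Proof. by move=> Lv; rewrite norm0v_snorm//; exact: snorm_component. Qed.

Let a0 : 0 < c0 + alpha ^+ 2 / M.
Proof. by rewrite ltr_wpDr// divr_ge0 ?sqr_ge0// ltW// lameM_gt0. Qed.

Lemma sqrt_kappa_xi_measurable : measurable_fun Omega (sqrt_kappa_xi xi kappa).
Proof.
apply: (measurableT_comp (continuous_measurable_fun (@sqrt_continuous R))).
exact: measurable_funM.
Qed.

Lemma sqrt_kappa_xi_bounds x : Omega x ->
  Num.sqrt (kappa1 / xi) <= sqrt_kappa_xi xi kappa x <= Num.sqrt (kappa2 / xi).
Proof.
move=> /hkappa /andP[h1 h2]; rewrite /sqrt_kappa_xi; apply/andP; split.
  by rewrite ler_wsqrtr// ler_wpM2r// invr_ge0 ltW.
by rewrite ler_wsqrtr// ler_wpM2r// invr_ge0 ltW.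
Qed.

Local Notation sqrt_rho1 := (fun x => Num.sqrt (rho1 muP lambdaP alpha c0 xi kappa x)).

Lemma sqrt_rho1_measurable : measurable_fun Omega sqrt_rho1.
Proof.
apply: (measurableT_comp (continuous_measurable_fun (@sqrt_continuous R))).
apply: measurable_minr => //.
(* The inverse is written as a real power, which is measurable; the two agree on [Omega], where the
   base is nonnegative. *)
have : measurable_fun Omega (fun x => (kappa x / xi) `^ (-1)).
  by apply: (measurableT_comp (@measurable_powR R (-1))); exact: measurable_funM.
apply: eq_measurable_fun => x /set_mem /hkappa /andP[h1 _].
by rewrite powR_inv1// divr_ge0// ltW// (lt_le_trans hkappa1).
Qed.

Lemma sqrt_rho1_bounds x : Omega x ->
  Num.sqrt (Num.min (c0 + alpha ^+ 2 / M)^-1 (kappa2 / xi)^-1) <= sqrt_rho1 x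
    <= Num.sqrt (c0 + alpha ^+ 2 / M)^-1.
Proof.
move=> /hkappa /andP[h1 h2]; have k0 := lt_le_trans hkappa1 h1.
rewrite /rho1; apply/andP; split; rewrite ler_wsqrtr//; last by rewrite ge_min lexx.
rewrite le_min !ge_min lexx /=; apply/orP; right.
by rewrite lef_pV2 ?posrE ?divr_gt0// ler_wpM2r// invr_ge0 ltW.
Qed.

(** The weights are bounded below on [Omega], by [r1] for [g] and [r0] for [s]. One [K], the sum of
    the three individual constants, serves all data. *)
Lemma data_norm_bounds : exists2 K, 0 <= K &
  forall f g s, L2v Omega f -> L2v Omega g -> L2 Omega s ->
  let D := data_norm Omega muP lambdaP alpha c0 xi rho kappa f g s in
  [/\ 0 <= D, forall i, nrm (f i) <= K * D, forall j, nrm (g j) <= K * D & nrm s <= K * D].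
Proof.
pose r1 := Num.sqrt (kappa1 / xi) * rho.
pose r0 := Num.sqrt (Num.min (c0 + alpha ^+ 2 / M)^-1 (kappa2 / xi)^-1).
have r10 : 0 < r1 by rewrite mulr_gt0// sqrtr_gt0 divr_gt0.
have r00 : 0 < r0 by rewrite sqrtr_gt0 lt_min !invr_gt0 a0 divr_gt0.
have m0 : 0 < Num.sqrt muP by rewrite sqrtr_gt0.
exists (Num.sqrt muP + r1^-1 + r0^-1).
  by rewrite !addr_ge0// ?invr_ge0 ltW.
move=> f g s Lf Lg Ls D.
pose A := norm0v Omega f; pose C := norm0 Omega (fun x => sqrt_rho1 x * s x).
pose B := norm0v Omega (weighted (sqrt_kappa_xi xi kappa) (fun i x => rho * g i x)).
have [A0 B0 C0] : [/\ 0 <= A, 0 <= B & 0 <= C] by split; exact: sqrtr_ge0.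
have DE : D = (Num.sqrt muP)^-1 * A + B + C by [].
have A0' : 0 <= (Num.sqrt muP)^-1 * A by rewrite mulr_ge0// invr_ge0 ltW.
have D0 : 0 <= D by rewrite DE !addr_ge0.
have scale (r X Y : R) : 0 < r -> r * X <= Y -> Y <= D -> X <= r^-1 * D.
  by move=> rr h1 h2; rewrite ler_pdivlMl// (le_trans h1).
have weak (r X : R) : 0 <= r -> r <= Num.sqrt muP + r1^-1 + r0^-1 ->
    X <= r * D -> X <= (Num.sqrt muP + r1^-1 + r0^-1) * D.
  by move=> rr h1 /le_trans; apply; exact: ler_wpM2r.
have V1 : 0 < r1^-1 by rewrite invr_gt0.
have V0 : 0 < r0^-1 by rewrite invr_gt0.
split => // [i|j|].
- apply: (weak (Num.sqrt muP)); [exact: ltW|lra|].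
  apply: (le_trans (component_le_norm0v i Lf)); rewrite -/A -ler_pdivrMl//.
  by rewrite DE -addrA lerDl addr_ge0.
- apply: (weak r1^-1); [exact: ltW|lra|].
  apply: (scale _ _ B) => //; last by rewrite DE; lra.
  have Lrg k : L2 Omega (fun x => rho * g k x) by exact: L2Z.
  have Lw : L2v Omega (weighted (sqrt_kappa_xi xi kappa) (fun i x => rho * g i x)).
    move=> k; apply: (weight_L2 mO sqrt_kappa_xi_measurable (K := Num.sqrt (kappa2 / xi))
      _ (Lrg k)).
    by move=> x /sqrt_kappa_xi_bounds /andP[h1 h2]; rewrite ger0_norm// (le_trans _ h1).
  apply: le_trans (component_le_norm0v j Lw).
  have := weight_nrm_ge mO sqrt_kappa_xi_measurable sqrt_kappa_xi_bounds (sqrtr_ge0 _) (Lrg j).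
  apply: le_trans; rewrite /r1 -mulrA ler_wpM2l//.
  have := snormZ L2ip rho (Lg j); rewrite gtr0_norm// => <-.
  by [].
- apply: (weak r0^-1); [exact: ltW|lra|].
  apply: (scale _ _ C) => //; last by rewrite DE; lra.
  rewrite /C norm0E.
  exact: (weight_nrm_ge mO sqrt_rho1_measurable sqrt_rho1_bounds (sqrtr_ge0 _) Ls).
Qed.

Lemma reduced_load_lin f g s : L2v Omega f -> L2v Omega g -> L2 Omega s ->
  forall t z z', LW z -> LW z' ->
  reduced_load f g s (t *: z + z') = t * reduced_load f g s z + reduced_load f g s z'.
Proof.
move=> Lf Lg Ls t z z' Lz Lz'; have ipr := bilinearr (semi_inner_bilinear L2ip).
have Lkg j : L2 Omega (fun x => kappa x * g j x) by exact: weight_L2 kappa_le (Lg j).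
rewrite /reduced_load.
have -> : \sum_i ip (f i) ((t *: z + z') (Some i, None)) =
    t * (\sum_i ip (f i) (z (Some i, None))) + \sum_i ip (f i) (z' (Some i, None)).
  by rewrite mulr_sumr -big_split; apply: eq_bigr => i _; exact: ipr.
have -> : \sum_j ip (fun x => kappa x * g j x) ((t *: z + z') (None, Some j)) =
    t * (\sum_j ip (fun x => kappa x * g j x) (z (None, Some j))) +
    \sum_j ip (fun x => kappa x * g j x) (z' (None, Some j)).
  by rewrite mulr_sumr -big_split; apply: eq_bigr => i _; exact: ipr.
have -> : ip s ((t *: z + z') (None, None)) = t * ip s (z (None, None)) + ip s (z' (None, None)).
  exact: ipr.
ring.
Qed.

Lemma reduced_load_bounded : exists2 K, 0 <= K &
  forall f g s, L2v Omega f -> L2v Omega g -> L2 Omega s -> forall z, LW z ->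
  `|reduced_load f g s z| <=
    K * data_norm Omega muP lambdaP alpha c0 xi rho kappa f g s * snorm ipW z.
Proof.
have [K K0 hK] := data_norm_bounds.
have rx0 : 0 <= rho / xi by rewrite divr_ge0 ?(ltW hrho) ?(ltW hxi).
(* One summand for each term of the load: [d] components of [f], [d] components of [g] weighted by
   [kappa], and [s]. *)
exists (d%:R * K + rho / xi * (d%:R * (kappa2 * K)) + K).
  have k20 := ltW hkappa2; apply: addr_ge0 => //; apply: addr_ge0; first exact: mulr_ge0.
  by do 2 (apply: mulr_ge0 => //); exact: mulr_ge0.
move=> f g s Lf Lg Ls z Lz; have [] := hK f g s Lf Lg Ls.
set D := data_norm _ _ _ _ _ _ _ _ _ _ _ => D0 hf hg hs.
have n0 : 0 <= snorm ipW z by exact: snorm_ge0.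
have cs (X Y : E -> R^o) (k : R) c : L2 Omega X -> Y = z c -> nrm X <= k ->
    `|ip X Y| <= k * snorm ipW z.
  move=> LX -> hX; apply: (le_trans (cauchy_schwarz L2ip LX (Lz c))).
  by apply: ler_pM; rewrite ?snorm_ge0//; exact: snorm_component.
have sum_le (F : 'I_d -> R) k : (forall i, `|F i| <= k) -> `|\sum_i F i| <= d%:R * k.
  move=> h; apply: (le_trans (ler_norm_sum _ _ _)).
  apply: (@le_trans _ _ (\sum_(i < d) k)); first exact: ler_sum.
  by rewrite sumr_const card_ord -[leLHS]mulr_natl.
have h1 : `|\sum_i ip (f i) (z (Some i, None))| <= d%:R * (K * D * snorm ipW z).
  by apply: sum_le => i; apply: (cs _ _ _ (Some i, None)).
have h2 : `|\sum_j ip (fun x => kappa x * g j x) (z (None, Some j))| <=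
    d%:R * (kappa2 * (K * D) * snorm ipW z).
  apply: sum_le => j; apply: (cs _ _ _ (None, Some j)) => //.
    exact: weight_L2 kappa_le (Lg j).
  apply: (le_trans (weight_nrm_le mO mkappa kappa_le (ltW hkappa2) (Lg j))).
  by rewrite ler_wpM2l// ltW.
have h3 : `|ip s (z (None, None))| <= K * D * snorm ipW z.
  exact: (cs _ _ _ (None, None)).
rewrite /reduced_load; move: n0 h1 h2 h3; move: (\sum_i _) (\sum_j _) (ip s _) (snorm _ z).
move=> A B C n n0 h1 h2 h3.
apply: (le_trans (ler_normD _ _)); apply: (le_trans (lerD (ler_normD _ _) h3)).
rewrite normrM (ger0_norm rx0).
have := ler_wpM2l rx0 h2; move: (rho / xi) rx0 => q q0 h4.
lra.
Qed.

Lemma ip0r (f h : E -> R) : (forall x, h x = 0) -> ip f h = 0.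
Proof.
move=> h0; rewrite /ip; under eq_Rintegral do rewrite h0 mulr0.
by rewrite Rintegral_cst// mul0r.
Qed.

Lemma ip_nrm0 (f h : E -> R) : L2 Omega f -> L2 Omega h -> nrm f = 0 -> ip f h = 0.
Proof.
move=> Lf Lh f0; apply/eqP; rewrite -normr_le0.
by have := cauchy_schwarz L2ip Lf Lh; rewrite f0 mul0r.
Qed.

Lemma ip_nrm_eq (f g h : E -> R^o) : L2 Omega f -> L2 Omega g -> L2 Omega h ->
  nrm (f - g) = 0 -> ip f h = ip g h.
Proof.
move=> Lf Lg Lh /(ip_nrm0 (subspaceB L2sub Lf Lg) Lh).
by rewrite (bilinear_onBl (semi_inner_bilinear L2ip))// => /eqP; rewrite subr_eq0 => /eqP.
Qed.

(** * Elimination of the rotation and the total pressure *)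

Definition jet_rotation (w : W) (k : 'I_(rot_dim d)) : E -> R^o :=
  Num.sqrt muP *: curl w k.

Definition jet_total_pressure (w : W) : E -> R^o :=
  alpha *: w (None, None) - M *: dv w.

(** Stated through seminorms because integral equations determine rotation and total pressure only
    almost everywhere. *)
Definition constitutive (w : W) (omega : 'I_(rot_dim d) -> E -> R^o) (phi : E -> R^o) : Prop :=
  (forall k, nrm (omega k - jet_rotation w k) = 0) /\ nrm (phi - jet_total_pressure w) = 0.

Let curl_L2 w k : LW w -> L2 Omega (curl w k).
Proof. by move=> Lw; exact: (bounded_map_L2 (bounded_map_curl hd mO k) Lw). Qed.

Let dv_L2 w : LW w -> L2 Omega (dv w).
Proof. by move=> Lw; exact: (bounded_map_L2 (bounded_map_div mO) Lw). Qed.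

Lemma jet_rotation_L2 w k : LW w -> L2 Omega (jet_rotation w k).
Proof. by move=> Lw; exact: (subspaceZ L2sub _ (curl_L2 k Lw)). Qed.

Lemma jet_total_pressure_L2 w : LW w -> L2 Omega (jet_total_pressure w).
Proof.
move=> Lw; apply: (subspaceB L2sub); apply: (subspaceZ L2sub); first exact: Lw.
exact: dv_L2.
Qed.

Lemma first_equationE w omega phi theta psi : LW w ->
  L2v Omega omega -> L2 Omega phi -> L2v Omega theta -> L2 Omega psi ->
  \sum_k ip (omega k) (theta k) + M^-1 * ip phi psi
   - Num.sqrt muP * (\sum_k ip (theta k) (curl w k)) + ip psi (dv w)
   - alpha / M * ip (w (None, None)) psi =
  \sum_k ip (omega k - jet_rotation w k : E -> R^o) (theta k)
   + M^-1 * ip (phi - jet_total_pressure w : E -> R^o) psi.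
Proof.
move=> Lw Lo Lp Lt Ls; have bl := semi_inner_bilinear L2ip.
have Lc k := curl_L2 k Lw; have Ld := dv_L2 Lw; have Lpr := Lw (None, None).
have -> : \sum_k ip (omega k - jet_rotation w k : E -> R^o) (theta k) =
    \sum_k ip (omega k) (theta k) - Num.sqrt muP * (\sum_k ip (theta k) (curl w k)).
  rewrite mulr_sumr -sumrB; apply: eq_bigr => k _.
  rewrite (bilinear_onBl bl (Lo k) (jet_rotation_L2 k Lw) (Lt k)).
  by rewrite (bilinear_onZl L2sub bl _ (Lc k) (Lt k)) (ipC _ (curl w k)).
rewrite (bilinear_onBl bl Lp (jet_total_pressure_L2 Lw) Ls).
rewrite (bilinear_onBl bl (subspaceZ L2sub alpha Lpr) (subspaceZ L2sub M Ld) Ls).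
rewrite (bilinear_onZl L2sub bl _ Lpr Ls) (bilinear_onZl L2sub bl _ Ld Ls).
rewrite (ipC _ (dv w)); have M0 : M != 0 by rewrite gt_eqF// lameM_gt0.
move: (\sum_k _) (\sum_k _) (ip _ _) (ip _ _) (ip _ _) => a b c e h.
move: (M) M0 => m m0; by field.
Qed.

(** Testing with the two residuals themselves yields a vanishing sum of squares with positive
    weights. *)
Lemma first_equation_constitutive w omega phi : LW w ->
  L2v Omega omega -> L2 Omega phi ->
  (forall theta psi, L2v Omega theta -> L2 Omega psi ->
    \sum_k ip (omega k) (theta k) + M^-1 * ip phi psi
    - Num.sqrt muP * (\sum_k ip (theta k) (curl w k)) + ip psi (dv w)
    - alpha / M * ip (w (None, None)) psi = 0) <->
  constitutive w omega phi.
Proof.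
move=> Lw Lo Lp.
have Ltheta k : L2 Omega (omega k - jet_rotation w k : E -> R^o).
  by apply: (subspaceB L2sub) => //; exact: jet_rotation_L2.
have Lpsi : L2 Omega (phi - jet_total_pressure w : E -> R^o).
  by apply: (subspaceB L2sub) => //; exact: jet_total_pressure_L2.
split => [H|[ho hp] theta psi Lt Ls]; last first.
  rewrite first_equationE// (ip_nrm0 Lpsi Ls hp) mulr0 addr0.
  by apply: big1 => k _; exact: ip_nrm0.
have M0 : 0 < M^-1 by rewrite invr_gt0 lameM_gt0.
have := H _ _ Ltheta Lpsi; rewrite first_equationE//.
have ip0 f : L2 Omega f -> 0 <= ip f f by exact: (semi_inner_ge0 L2ip).
have s0 : 0 <= \sum_k ip (omega k - jet_rotation w k : E -> R^o) (omega k - jet_rotation w k).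
  by apply: sumr_ge0 => k _; exact: ip0.
have p0 := mulr_ge0 (ltW M0) (ip0 _ Lpsi).
move=> /eqP; rewrite paddr_eq0// => /andP[/eqP h1 h2]; split => [k|].
  have /(_ k isT)/eqP := psumr_eq0P (fun k _ => ip0 _ (Ltheta k)) h1.
  by rewrite /snorm => /eqP ->; rewrite sqrtr0.
move: h2; rewrite mulf_eq0 gt_eqF//= => /eqP h2.
by rewrite /snorm h2 sqrtr0.
Qed.

Definition form_displacement (w z : W) : R :=
  muP * (\sum_k ip (curl w k) (curl z k)) + M * ip (dv w) (dv z)
  - alpha * ip (w (None, None)) (dv z).

Definition form_pressure (w z : W) : R :=
  alpha * ip (dv w) (z (None, None)) + c0 * ip (w (None, None)) (z (None, None))
  + xi^-1 * (\sum_j ip (fun x => kappa x * w (None, Some j) x) (z (None, Some j))).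

Lemma reduced_formE w z : reduced_form w z = form_displacement w z + form_pressure w z.
Proof. by rewrite /reduced_form /form_displacement /form_pressure; ring. Qed.

Lemma second_equationE w z omega phi : LW w -> LW z ->
  L2v Omega omega -> L2 Omega phi -> constitutive w omega phi ->
  - Num.sqrt muP * (\sum_k ip (omega k) (curl z k)) + ip phi (dv z) =
  - form_displacement w z.
Proof.
move=> Lw Lz Lo Lp [ho hp]; have bl := semi_inner_bilinear L2ip.
have Ld := dv_L2 Lz; have Ldw := dv_L2 Lw; have Lpr := Lw (None, None).
have -> : \sum_k ip (omega k) (curl z k) = Num.sqrt muP * (\sum_k ip (curl w k) (curl z k)).
  rewrite mulr_sumr; apply: eq_bigr => k _.
  rewrite (ip_nrm_eq (Lo k) (jet_rotation_L2 k Lw) (curl_L2 k Lz) (ho k)).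
  by rewrite (bilinear_onZl L2sub bl _ (curl_L2 k Lw) (curl_L2 k Lz)).
rewrite (ip_nrm_eq Lp (jet_total_pressure_L2 Lw) Ld hp).
rewrite (bilinear_onBl bl (subspaceZ L2sub alpha Lpr) (subspaceZ L2sub M Ldw) Ld).
rewrite (bilinear_onZl L2sub bl _ Lpr Ld) (bilinear_onZl L2sub bl _ Ldw Ld).
rewrite /form_displacement mulrA mulNr -expr2 sqr_sqrtr ?ltW//.
ring.
Qed.

(** Substituting alpha p - M div u produces a term alpha^2 / M (p, q) that cancels against the one
    in the equation. *)
Lemma third_equationE w z phi : LW w -> LW z -> L2 Omega phi ->
  nrm (phi - jet_total_pressure w : E -> R^o) = 0 ->
  alpha / M * ip (z (None, None)) phi
  - (c0 + alpha ^+ 2 / M) * ip (w (None, None)) (z (None, None))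
  - xi^-1 * (\sum_j ip (fun x => kappa x * w (None, Some j) x) (z (None, Some j))) =
  - form_pressure w z.
Proof.
move=> Lw Lz Lp hp; have bl := semi_inner_bilinear L2ip.
have Ldw := dv_L2 Lw; have Lpr := Lw (None, None); have Lq := Lz (None, None).
rewrite (ipC _ (z _)) (ip_nrm_eq Lp (jet_total_pressure_L2 Lw) Lq hp).
rewrite (bilinear_onBl bl (subspaceZ L2sub alpha Lpr) (subspaceZ L2sub M Ldw) Lq).
rewrite (bilinear_onZl L2sub bl _ Lpr Lq) (bilinear_onZl L2sub bl _ Ldw Lq).
have M0 : M != 0 by rewrite gt_eqF// lameM_gt0.
rewrite /form_pressure; move: (\sum_j _) (ip _ _) (ip _ _) => a b c.
by move: (M) M0 (xi^-1) => m m0 y; field.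
Qed.

(** * Equivalence of the three equations with the reduced problem *)

Section reduction.
Variables (f g : 'I_d -> E -> R) (s : E -> R).
Hypotheses (Lf : L2v Omega f) (Lg : L2v Omega g) (Ls : L2 Omega s).
Variables (u : 'I_d -> H1 Omega) (p : H1 Omega).
Variables (omega : 'I_(rot_dim d) -> E -> R) (phi : E -> R).
Local Notation w := (biot_jet u p).
Local Notation solution := (biot_solution muP lambdaP alpha c0 xi rho kappa f g s u omega phi p).

Let load_displacement (z : W) := \sum_i ip (f i) (z (Some i, None)).

Let load_pressure (z : W) :=
  rho / xi * (\sum_j ip (fun x => kappa x * g j x) (z (None, Some j))) + ip s (z (None, None)).

Let loadE z : reduced_load f g s z = load_displacement z + load_pressure z.
Proof. by rewrite /reduced_load addrA. Qed.

Let Lc (v : 'I_d -> H1 Omega) : H10v v -> forall q, LW (biot_jet v q).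
Proof. by move=> hv q; exact/biot_space_L2/biot_jet_space. Qed.

Let first_equation : H10v u -> L2v Omega omega -> L2 Omega phi ->
  (forall theta psi, L2v Omega theta -> L2 Omega psi ->
     \int[lebesgue_rV d]_(x in Omega) dot omega theta x
     + M^-1 * \int[lebesgue_rV d]_(x in Omega) (phi x * psi x)
     - Num.sqrt muP * \int[lebesgue_rV d]_(x in Omega) dot theta (Defs.curl u) x
     + \int[lebesgue_rV d]_(x in Omega) (psi x * divergence u x)
     - alpha / M * \int[lebesgue_rV d]_(x in Omega) (p x * psi x) = 0) <->
  constitutive w omega phi.
Proof.
move=> hu Lo Lp; rewrite -(first_equation_constitutive (Lc hu p) Lo Lp).
have Lcu : L2v Omega (Defs.curl u) by move=> k; exact: (curl_L2 k (Lc hu p)).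
by split => H theta psi Lt Lpsi; have := H theta psi Lt Lpsi; rewrite !dot_integral.
Qed.

(** The pressure [q] is arbitrary: both sides see only the displacement part of [biot_jet v q]. *)
Let second_equation (v : 'I_d -> H1 Omega) (q : H1 Omega) :
  H10v u -> L2v Omega omega -> L2 Omega phi ->
  constitutive w omega phi -> H10v v ->
  (- Num.sqrt muP * \int[lebesgue_rV d]_(x in Omega) dot omega (Defs.curl v) x
   + \int[lebesgue_rV d]_(x in Omega) (phi x * divergence v x)
   = - \int[lebesgue_rV d]_(x in Omega) dot f (fun i => v i) x) <->
  form_displacement w (biot_jet v q) = load_displacement (biot_jet v q).
Proof.
move=> hu Lo Lp hc hv; have Lz := Lc hv q.
have Lcv : L2v Omega (Defs.curl v) by move=> k; exact: (curl_L2 k Lz).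
have Lv : L2v Omega (fun i => v i) by move=> k; exact: (Lz (Some k, None)).
rewrite !dot_integral//.
have E2 := second_equationE (Lc hu p) Lz Lo Lp hc.
split => [H|H].
  by apply: oppr_inj; rewrite -E2.
by apply: (etrans E2); rewrite H.
Qed.

Let third_equation (v : 'I_d -> H1 Omega) (q : H1 Omega) : H10v u -> L2 Omega phi ->
  constitutive w omega phi -> H10v v ->
  (alpha / M * \int[lebesgue_rV d]_(x in Omega) (q x * phi x)
     - (c0 + alpha ^+ 2 / M) * \int[lebesgue_rV d]_(x in Omega) (p x * q x)
     - xi^-1 * \int[lebesgue_rV d]_(x in Omega) (kappa x * dot (grad p) (grad q) x)
     = - (rho / xi) * \int[lebesgue_rV d]_(x in Omega) (kappa x * dot g (grad q) x)
       - \int[lebesgue_rV d]_(x in Omega) (s x * q x)) <->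
  form_pressure w (biot_jet v q) = load_pressure (biot_jet v q).
Proof.
move=> hu Lp [_ hp] hv; have Lz := Lc hv q.
have Lgq : L2v Omega (grad q) by exact: grad_L2.
rewrite !weighted_dot_integral//; last exact: grad_L2.
have E3 := third_equationE (Lc hu p) Lz Lp hp.
have LE : - load_pressure (biot_jet v q) =
  - (rho / xi) * (\sum_j ip (fun x => kappa x * g j x) (grad q j)) - ip s q.
  by rewrite /load_pressure opprD mulNr.
split => [H|H].
  by apply: oppr_inj; rewrite LE -E3.
by apply: (etrans E3); rewrite H.
Qed.

Lemma solution_reduced : solution ->
  [/\ S w, LW w, constitutive w omega phi &
    forall z, S z -> reduced_form w z = reduced_load f g s z].
Proof.
move=> [[hu Lo Lp] E1 E2 E3]; have hc := (first_equation hu Lo Lp).1 E1.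
split => //; [exact: biot_jet_space|exact: Lc|].
move=> _ /biot_space_jet[v [q [hv <-]]]; rewrite reduced_formE loadE.
by rewrite ((second_equation q hu Lo Lp hc hv).1 (E2 v hv))
  ((third_equation q hu Lp hc hv).1 (E3 q)).
Qed.

(** The single reduced equation is split by testing with jets whose pressure, respectively whose
    displacement, is zero. *)
Lemma reduced_solution : H10v u -> L2v Omega omega -> L2 Omega phi ->
  constitutive w omega phi -> (forall z, S z -> reduced_form w z = reduced_load f g s z) ->
  solution.
Proof.
move=> hu Lo Lp hc H; split => //; first exact/first_equation.
- move=> v hv; have [q hq] := weak_jet_H1 (weak_jet0 mO).
  apply/(second_equation q) => //.
  have := H _ (biot_jet_space q hv); rewrite reduced_formE loadE.
  have z0 j x : biot_jet v q (None, j) x = 0 by rewrite /biot_jet hq.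
  have lp0 : load_pressure (biot_jet v q) = 0.
    rewrite /load_pressure big1 => [|j _]; last exact: ip0r.
    by rewrite (ip0r _ (z0 _)) mulr0 addr0.
  have fp0 : form_pressure w (biot_jet v q) = 0.
    rewrite /form_pressure big1 => [|j _]; last exact: ip0r.
    by rewrite !(ip0r _ (z0 _)) !mulr0 !addr0.
  by rewrite lp0 fp0 !addr0.
- move=> q; have [r hr] := weak_jet_H1 (weak_jet0 mO).
  pose v (i : 'I_d) := r.
  have hv : H10v v by move=> i; apply/in_H10P; rewrite hr; exact: (H10_jet0 mO).
  apply/(third_equation (v := v) q) => //.
  have := H _ (biot_jet_space q hv); rewrite reduced_formE loadE.
  have z0 i j x : biot_jet v q (Some i, j) x = 0 by rewrite /biot_jet /= hr.
  have ld0 : load_displacement (biot_jet v q) = 0.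
    by rewrite /load_displacement big1 => // j _; exact: ip0r.
  have cz k x : curl (biot_jet v q) k x = 0.
    rewrite -[RHS](curl_mx0 R hd k) /jet_curl; congr (curl_mx _ k).
    by apply/funext => i; apply/funext => j; exact: z0.
  have d0 x : dv (biot_jet v q) x = 0.
    by rewrite /jet_div big1 => // i _; exact: z0.
  have fd0 : form_displacement w (biot_jet v q) = 0.
    rewrite /form_displacement big1 => [|k _]; last exact: ip0r.
    by rewrite !(ip0r _ d0) !mulr0 subr0 addr0.
  by rewrite ld0 fd0 !add0r.
Qed.

End reduction.

(** * Bounding the energy norm by the norm of the jet *)

Lemma mean_free_le : exists2 C, 0 <= C &
  forall h, L2 Omega h -> norm0 Omega (mean_free Omega h) <= C * nrm h.
Proof.
pose one : E -> R^o := fun=> 1; pose m := (fine (lebesgue_rV d Omega))^-1.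
have L1 : L2 Omega one by apply: (bounded_L2 mO OL (K := 1)) => [|x _];
  [exact: measurable_cst|rewrite normr1].
exists (1 + `|m| * nrm one * nrm one).
  by rewrite addr_ge0// !mulr_ge0// snorm_ge0.
move=> h Lh; rewrite norm0E.
(* Subtracting the mean is subtracting a multiple of the constant function 1, whose coefficient
   Cauchy-Schwarz bounds. *)
have -> : mean_free Omega h = (h - (m * ip h one) *: one : E -> R^o).
  apply/funext => x; rewrite /mean_free /ip /one.
  under [in RHS]eq_Rintegral do rewrite mulr1.
  by rewrite -[RHS]/(h x - m * (\int[lebesgue_rV d]_(y in Omega) h y) * 1) mulr1.
apply: (le_trans (snormB L2ip Lh (subspaceZ L2sub _ L1))).
rewrite (snormZ L2ip _ L1) mulrDl mul1r lerD2l normrM.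
have := cauchy_schwarz L2ip Lh L1.
move: (snorm_ge0 ip one) (normr_ge0 m); move: (nrm one) (nrm h) `|ip h one| `|m|.
move=> a b c e ha he H; have := ler_wpM2l he (ler_wpM2r ha H); lra.
Qed.

Lemma norm0v_bounded_map m (A : 'I_m -> W -> E -> R^o) :
  (forall k, bounded_map Omega (A k)) -> exists2 C, 0 <= C &
  forall w, LW w -> norm0v Omega (fun k => A k w) <= C * snorm ipW w.
Proof.
move=> hA; have /choice[C hC] k : exists C, 0 <= C /\
    forall w, LW w -> nrm (A k w) <= C * snorm ipW w.
  by have [_ _ [C C0 H]] := hA k; exists C.
exists (\sum_k C k) => [|w Lw]; first by apply: sumr_ge0 => k _; case: (hC k).
have LA : L2v Omega (fun k => A k w) by move=> k; exact: (bounded_map_L2 (hA k)).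
rewrite norm0v_snorm// (le_trans (snorm_family_le mO LA))// mulr_suml.
by apply: ler_sum => k _; exact: (hC k).2.
Qed.

Lemma sqr_le_scaled (a b x n : R) : 0 <= a -> 0 <= x -> x <= b * n ->
  a * x ^+ 2 <= a * b ^+ 2 * n ^+ 2.
Proof.
move=> ha hx h; rewrite -mulrA -exprMn ler_wpM2l// lerXn2r ?nnegrE//.
exact: le_trans h.
Qed.

Lemma bounded_map_total_pressure : bounded_map Omega jet_total_pressure.
Proof.
rewrite (_ : jet_total_pressure = (fun w => alpha *: w (None, None) + ((- M) *: dv w + 0))).
  apply: bounded_mapL => //; apply: bounded_mapL; [|exact: bounded_map_div|exact: bounded_map0].
  exact: mO.
by apply/funext => w; rewrite addr0 scaleNr.
Qed.

(** Every term is the norm of a bounded map of the jet, or of a function that differs from such a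
    map by seminorm zero. *)
Lemma energy_norm_bounded : exists2 K, 0 <= K &
  forall (u : 'I_d -> H1 Omega) (p : H1 Omega) omega phi,
  H10v u -> L2v Omega omega -> L2 Omega phi -> constitutive (biot_jet u p) omega phi ->
  energy_norm muP lambdaP alpha c0 xi kappa u omega phi p <= K * snorm ipW (biot_jet u p).
Proof.
have bcurl k : bounded_map Omega (fun w => curl w k) by exact: bounded_map_curl.
have bdiv := bounded_map_div mO.
have [C1 C10 hC1] := norm0v_bounded_map bcurl.
have [_ _ [C2 C20 hC2]] := bdiv.
have brot k : bounded_map Omega (fun w => jet_rotation w k).
  rewrite (_ : (fun w => _) = (fun w => Num.sqrt muP *: curl w k + 0)).
    by apply: bounded_mapL => //; exact: bounded_map0.
  by apply/funext => w; rewrite addr0.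
have [C3 C30 hC3] := norm0v_bounded_map brot.
have [_ _ [C4 C40 hC4]] := bounded_map_total_pressure.
have [C5 C50 hC5] := mean_free_le.
have bgrad j : bounded_map Omega (fun (w : W) x => sqrt_kappa_xi xi kappa x * w (None, Some j) x).
  apply: (bounded_map_weight mO sqrt_kappa_xi_measurable (K := Num.sqrt (kappa2 / xi)));
    [|exact: sqrtr_ge0|exact: cmp].
  by move=> x /sqrt_kappa_xi_bounds /andP[h1 h2]; rewrite ger0_norm// sqrtr_ge0.
have [C6 C60 hC6] := norm0v_bounded_map bgrad.
have M0 := lameM_gt0.
(* The weights of the energy norm times the squared constants of its seven terms. *)
pose Q := muP * C1 ^+ 2 + muP * C2 ^+ 2 + C3 ^+ 2 + muP^-1 * (C5 * C4) ^+ 2 + M^-1 * C4 ^+ 2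
  + (c0 + alpha ^+ 2 / M) * 1 ^+ 2 + C6 ^+ 2.
exists (Num.sqrt Q); first exact: sqrtr_ge0.
move=> u p omega phi hu Lo Lp [ho hp].
have Lw := biot_space_L2 (biot_jet_space p hu); set w := biot_jet u p in Lw ho hp *.
set n := snorm _ w; have n0 : 0 <= n by exact: snorm_ge0.
have nz (X Y : E -> R^o) : L2 Omega X -> L2 Omega Y -> nrm (X - Y) = 0 -> nrm X <= nrm Y.
  move=> LX LY h; have := snormD L2ip (subspaceB L2sub LX LY) LY.
  by rewrite subrK h add0r.
have p1 : norm0v Omega (Defs.curl u) <= C1 * n by exact: hC1.
have p2 : norm0 Omega (divergence u) <= C2 * n by rewrite norm0E; exact: hC2.
have p3 : norm0v Omega omega <= C3 * n.
  apply: le_trans (hC3 _ Lw); rewrite !norm0v_snorm//; last first.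
    by move=> k; exact: jet_rotation_L2.
  rewrite ler_wsqrtr//; apply: ler_sum => k _.
  have Lr := jet_rotation_L2 k Lw.
  rewrite -(sqr_snorm L2ip (Lo k)) -(sqr_snorm L2ip Lr) lerXn2r ?nnegrE ?snorm_ge0//.
  exact: nz.
have p4 : nrm phi <= C4 * n.
  apply: le_trans (hC4 _ Lw); apply: nz => //; exact: jet_total_pressure_L2.
have p5 : norm0 Omega (mean_free Omega phi) <= C5 * C4 * n.
  by rewrite (le_trans (hC5 _ Lp))// -mulrA ler_wpM2l.
have p6 : norm0 Omega p <= 1 * n.
  by rewrite mul1r norm0E; exact: (snorm_component mO (None, None) Lw).
have p7 : norm0v Omega (weighted (sqrt_kappa_xi xi kappa) (grad p)) <= C6 * n.
  exact: hC6.
rewrite -[X in _ * X]ger0_norm// -sqrtr_sqr -sqrtrM; last first.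
  have mu0 := ltW hmuP; have a0' := ltW a0.
  by rewrite /Q !addr_ge0// ?mulr_ge0// ?invr_ge0// ?exprn_ge0// ltW.
rewrite ler_wsqrtr// /Q (norm0E _ phi).
have mu0 := ltW hmuP.
have mu0' : 0 <= muP^-1 by rewrite invr_ge0.
have M0' : 0 <= M^-1 by rewrite invr_ge0 ltW.
have q1 := sqr_le_scaled mu0 (sqrtr_ge0 _) p1.
have q2 := sqr_le_scaled mu0 (sqrtr_ge0 _) p2.
have q3 := sqr_le_scaled ler01 (sqrtr_ge0 _) p3.
have q4 := sqr_le_scaled M0' (snorm_ge0 _ _) p4.
have q5 := sqr_le_scaled mu0' (sqrtr_ge0 _) p5.
have q6 := sqr_le_scaled (ltW a0) (sqrtr_ge0 _) p6.
have q7 := sqr_le_scaled ler01 (sqrtr_ge0 _) p7.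
rewrite !mul1r in q3 q7.
have := lerD (lerD (lerD (lerD (lerD (lerD q1 q2) q3) q5) q4) q6) q7.
by rewrite -!mulrDl mulrDr; exact.
Qed.

Local Notation solution f g s u omega phi p :=
  (@biot_solution R d Omega muP lambdaP alpha c0 xi rho kappa f g s u omega phi p).

(** * Energy estimate, existence and uniqueness *)

Lemma biot_energy_estimate : exists2 C, 0 < C &
  forall f g s, L2v Omega f -> L2v Omega g -> L2 Omega s ->
  forall (u : 'I_d -> H1 Omega) omega phi (p : H1 Omega), solution f g s u omega phi p ->
  energy_norm muP lambdaP alpha c0 xi kappa u omega phi p <=
  C * data_norm Omega muP lambdaP alpha c0 xi rho kappa f g s.
Proof.
have [c cgt0 hc] := reduced_form_coercive.
have [K K0 hK] := reduced_load_bounded; have [Ke Ke0 hKe] := energy_norm_bounded.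
have [K' _ hD] := data_norm_bounds.
(* Coercivity and the load bound give [c * n ^+ 2 <= K * D * n], hence [n <= K / c * D]; the [+ 1]
   only makes the constant strictly positive. *)
exists (Ke * (K / c) + 1) => [|f g s Lf Lg Ls u omega phi p sol].
  by rewrite ltr_wpDl// mulr_ge0// divr_ge0// ltW.
have [D0 _ _ _] := hD f g s Lf Lg Ls.
have [Sw Lw hw E] := solution_reduced Lf Lg sol; have [[hu Lo Lp] _ _ _] := sol.
have := hKe u p omega phi hu Lo Lp hw.
have := hc _ Sw; rewrite (E _ Sw) -(sqr_snorm (L2_family_semi_inner mO _) Lw).
have := hK f g s Lf Lg Ls _ Lw; have := ler_norm (reduced_load f g s (biot_jet u p)).
move: D0; move: (data_norm _ _ _ _ _ _ _ _ _ _ _) (energy_norm _ _ _ _ _ _ _ _ _ _) => D e D0.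
have := snorm_ge0 ipW (biot_jet u p); move: (snorm _ _) (reduced_load _ _ _ _) =>
  n l n0 h1 h2 h3 h4.
have hn : n <= K / c * D.
  have [->|nz] := eqVneq n 0; first by rewrite mulr_ge0// divr_ge0// ltW.
  have np : 0 < n by rewrite lt_neqAle eq_sym nz.
  rewrite mulrAC ler_pdivlMr// mulrC -(ler_pM2r np) -mulrA -expr2.
  exact: le_trans (le_trans h1 h2).
apply: (le_trans h4); rewrite mulrDl mul1r; have := ler_wpM2l Ke0 hn; lra.
Qed.

Lemma biot_solution_exists f g s : L2v Omega f -> L2v Omega g -> L2 Omega s ->
  exists u omega phi p, solution f g s u omega phi p.
Proof.
move=> Lf Lg Ls; have [[fl fr] [C C0 hC]] := reduced_form_bounded.
have [c cgt0 hc] := reduced_form_coercive; have [K K0 hK] := reduced_load_bounded.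
have bl : bilinear_on S reduced_form.
  by split => a x y z /biot_space_L2 Lx /biot_space_L2 Ly /biot_space_L2 Lz; auto.
have hb x y : S x -> S y -> `|reduced_form x y| <= C * snorm ipW x * snorm ipW y.
  by move=> /biot_space_L2 Lx /biot_space_L2 Ly; exact: hC.
have ll t x y : S x -> S y ->
    reduced_load f g s (t *: x + y) = t * reduced_load f g s x + reduced_load f g s y.
  by move=> /biot_space_L2 Lx /biot_space_L2 Ly; exact: reduced_load_lin.
have lb x (Sx : S x) := hK f g s Lf Lg Ls x (biot_space_L2 Sx).
have [w Sw HE] := lax_milgram (biot_space_semi_inner mO OL) (biot_space_complete mO OL)
  bl cgt0 hb hc ll lb.
have [u [p [hu uE]]] := biot_space_jet Sw; have Lw := biot_space_L2 Sw.
(* Rotation and total pressure are defined by the constitutive laws, so their residuals vanish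
   identically. *)
exists u, (jet_rotation w), (jet_total_pressure w), p.
have n0 (X : E -> R^o) : nrm (X - X) = 0.
  by rewrite subrr /snorm (ip0r _ (fun=> erefl)) sqrtr0.
apply: reduced_solution => //; rewrite ?uE//.
- by move=> k; exact: jet_rotation_L2.
- exact: jet_total_pressure_L2.
Qed.

Lemma ae_eq_nrm (X Y : E -> R^o) : L2 Omega X -> L2 Omega Y -> nrm (X - Y) = 0 ->
  ae_eq (lebesgue_rV d) Omega X Y.
Proof.
move=> LX LY /(snorm_eq0_ae mO (subspaceB L2sub LX LY)).
by apply: filterS => x h /h /eqP; rewrite subr_eq0 => /eqP.
Qed.

Lemma biot_solution_unique f g s u omega phi p u' omega' phi' p' :
  L2v Omega f -> L2v Omega g -> L2 Omega s ->
  solution f g s u omega phi p -> solution f g s u' omega' phi' p' ->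
  [/\ forall i, eqH1 (u' i) (u i),
      forall k, ae_eq (lebesgue_rV d) Omega (omega' k) (omega k),
      ae_eq (lebesgue_rV d) Omega phi' phi & eqH1 p' p].
Proof.
move=> Lf Lg Ls sol sol'.
have [Sw Lw [hw1 hw2] HE] := solution_reduced Lf Lg sol.
have [Sw' Lw' [hw1' hw2'] HE'] := solution_reduced Lf Lg sol'.
have [[_ Lo Lp] _ _ _] := sol; have [[_ Lo' Lp'] _ _ _] := sol'.
move: Sw Lw hw1 hw2 HE Sw' Lw' hw1' hw2' HE'.
have wE c j : biot_jet u p (c, j) = H1_jet (if c is Some i then u i else p) j by [].
have wE' c j : biot_jet u' p' (c, j) = H1_jet (if c is Some i then u' i else p') j by [].
move: (biot_jet u p) (biot_jet u' p') wE wE' => w w' wE wE'.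
move=> Sw Lw hw1 hw2 HE Sw' Lw' hw1' hw2' HE'.
have sub := biot_space_subspace mO OL.
have Sd := subspaceB sub Sw' Sw; have Ld := biot_space_L2 Sd.
have [c cgt0 hc] := reduced_form_coercive; have [[fl fr] _] := reduced_form_bounded.
(* Both jets solve the same linear problem, so the form vanishes at their difference and coercivity
   applies. *)
have n0 : snorm ipW (w' - w) = 0.
  have := hc _ Sd; rewrite (bilinear_onBl (Build_bilinear_on fl fr) Lw' Lw Ld).
  rewrite (HE _ Sd) (HE' _ Sd) subrr -(sqr_snorm (L2_family_semi_inner mO _) Ld).
  by rewrite pmulr_rle0// => h; apply/eqP; rewrite -sqrf_eq0 eq_le h sqr_ge0.
have small A : bounded_map Omega A -> nrm (A w' - A w) = 0.
  move=> [lA LA [K K0 hK]]; have := hK _ Ld; rewrite n0 mulr0.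
  have -> : A (w' - w) = A w' - A w by rewrite addrC -scaleN1r lA scaleN1r addrC.
  by move=> h; apply/eqP; rewrite eq_le h snorm_ge0.
have ae i j : ae_eq (lebesgue_rV d) Omega (w' (i, j)) (w (i, j)).
  by apply: ae_eq_nrm => //; exact: (small _ (cmp i j)).
(* For the rotation and the total pressure [Y] and [Y'] are the values given by the two jets: each
   solution is close to its own [Y], and these are close to each other. *)
have chain (X Y X' Y' : E -> R^o) : L2 Omega X -> L2 Omega Y -> L2 Omega X' -> L2 Omega Y' ->
    nrm (X - Y) = 0 -> nrm (X' - Y') = 0 -> nrm (Y' - Y) = 0 ->
    ae_eq (lebesgue_rV d) Omega X' X.
  move=> LX LY LX' LY' e1 e2 e3; apply: ae_eq_nrm => //.
  have LB := subspaceB L2sub.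
  have -> : X' - X = (X' - Y') + ((Y' - Y) - (X - Y)).
    by rewrite opprB [Y' - Y + _]addrA subrK addrA subrK.
  apply/eqP; rewrite eq_le snorm_ge0 andbT.
  apply: (le_trans (snormD L2ip (LB _ _ LX' LY') (LB _ _ (LB _ _ LY' LY) (LB _ _ LX LY)))).
  by rewrite e2 add0r (le_trans (snormB L2ip (LB _ _ LY' LY) (LB _ _ LX LY)))// e1 e3 addr0.
split.
- move=> i; split; first by have := ae (Some i) None; rewrite wE wE'.
  by move=> j; have := ae (Some i) (Some j); rewrite wE wE'.
- move=> k; apply: (chain _ (jet_rotation w k) _ (jet_rotation w' k)) => //.
  + exact: jet_rotation_L2.
  + exact: jet_rotation_L2.
  have := small _ (bounded_map_curl hd mO k) => h.
  rewrite /jet_rotation -scalerBr (snormZ L2ip) ?h ?mulr0//.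
  by apply: (subspaceB L2sub); exact: curl_L2.
- apply: (chain _ (jet_total_pressure w) _ (jet_total_pressure w')) => //.
  + exact: jet_total_pressure_L2.
  + exact: jet_total_pressure_L2.
  exact: (small _ bounded_map_total_pressure).
- split; first by have := ae None None; rewrite wE wE'.
  by move=> j; have := ae None (Some j); rewrite wE wE'.
Qed.

End reduced_problem.

Theorem theoremA1 (R : realType) (d : nat) (hd : d = 2%N \/ d = 3%N)
    (Omega : set 'rV[R]_d) (hOmega : bounded_lipschitz_domain Omega)
    (muP lambdaP alpha c0 xi rho kappa1 kappa2 : R) (kappa : 'rV[R]_d -> R)
    (hmuP : 0 < muP) (hlambdaP : 0 <= lambdaP) (halpha : 0 < alpha)
    (hc0 : 0 < c0) (hxi : 0 < xi) (hrho : 0 < rho) (hkappa1 : 0 < kappa1)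
    (mkappa : measurable_fun Omega kappa)
    (hkappa : forall x, Omega x -> kappa1 <= kappa x <= kappa2) :
  (forall (f g : 'I_d -> 'rV[R]_d -> R) (s : 'rV[R]_d -> R),
     L2v Omega f -> L2v Omega g -> L2 Omega s ->
     exists u omega phi p,
       biot_solution muP lambdaP alpha c0 xi rho kappa f g s u omega phi p /\
       forall u' omega' phi' p',
         @biot_solution R d Omega muP lambdaP alpha c0 xi rho kappa f g s
           u' omega' phi' p' ->
         [/\ forall i, eqH1 (u' i) (u i),
             forall k, ae_eq (@lebesgue_rV R d) Omega (omega' k) (omega k),
             ae_eq (@lebesgue_rV R d) Omega phi' phi &
             eqH1 p' p])
  /\
  (exists2 C : R, 0 < C &
     forall (f g : 'I_d -> 'rV[R]_d -> R) (s : 'rV[R]_d -> R),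
       L2v Omega f -> L2v Omega g -> L2 Omega s ->
       forall (u : 'I_d -> H1 Omega) omega phi (p : H1 Omega),
         biot_solution muP lambdaP alpha c0 xi rho kappa f g s u omega phi p ->
         energy_norm muP lambdaP alpha c0 xi kappa u omega phi p <=
         C * data_norm Omega muP lambdaP alpha c0 xi rho kappa f g s).
Proof.
have [[x0 Ox0] oO _ [L [_ hL]] _] := hOmega.
have mO : measurable Omega by exact: open_measurable_rV.
(* Boundedness provides a bound by every number above [L], where [L] may be negative; [|L| + 1] is
   one such and is nonnegative. *)
have OL x : Omega x -> `|x| <= `|L| + 1.
  by move=> Ox; apply: (hL (`|L| + 1)) => //; rewrite (le_lt_trans (ler_norm L))// ltrDl.
have L0 : 0 <= `|L| + 1 by rewrite addr_ge0.
have k20 : 0 < kappa2.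
  by have /andP[h1 h2] := hkappa _ Ox0; exact: lt_le_trans hkappa1 (le_trans h1 h2).
split; last exact: (biot_energy_estimate hd mO L0 OL alpha hmuP hlambdaP hc0 hxi hrho
  hkappa1 mkappa hkappa k20).
move=> f g s Lf Lg Ls.
have [u [omega [phi [p sol]]]] := biot_solution_exists hd mO L0 OL alpha hmuP hlambdaP
  hc0 hxi hrho hkappa1 mkappa hkappa k20 Lf Lg Ls.
exists u, omega, phi, p; split => // u' omega' phi' p' sol'.
exact: (biot_solution_unique hd mO L0 OL hmuP hlambdaP
  hc0 hxi hkappa1 mkappa hkappa k20 Lf Lg Ls sol sol').
Qed.
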